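(* Let $h,k\geq 1$, let $c_{ij}>0$ for $i\in\{1,\ldots,h\}$, $j\in\{1,\ldots,k\}$, and let $\nu\in(0,1)$. Let $\{S_1(t)\}_{t\ge 0},\ldots,\{S_h(t)\}_{t\ge 0}$ be real-valued Lévy processes such that each $\kappa_{S_i}(\theta):=\log\mathbb{E}[e^{\theta S_i(1)}]$ ($\theta\in\mathbb{R}$) is finite in a neighborhood of $\theta=0$, and let $\{L_1^\nu(t)\}_{t\ge 0},\ldots,\{L_k^\nu(t)\}_{t\ge 0}$ be inverse stable subordinators of parameter $\nu$; all these $h+k$ processes are independent. Let $\Upsilon$ be the function defined by $$\Upsilon(\theta_1,\ldots,\theta_h):=\sum_{j=1}^k\left(\sum_{i=1}^hc_{ij}\kappa_{S_i}(\theta_i)\right)^{1/\nu}1_{\{\sum_{i=1}^hc_{ij}\kappa_{S_i}(\theta_i)\geq 0\}}$$ for all $(\theta_1,\ldots,\theta_h)\in\mathbb{R}^h$, and assume that $\Upsilon$ is essentially smooth and lower semicontinuous. Then the family of $\mathbb{R}^h$-valued random variables $$\left\{\left(\frac{S_1\left(\sum_{j=1}^kc_{1j}L_j^\nu(t)\right)}{t},\ldots,\frac{S_h\left(\sum_{j=1}^kc_{hj}L_j^\nu(t)\right)}{t}\right):t>0\right\}$$ satisfies the large deviation principle (as $t\to\infty$) with speed function $t$ and rate function $J_{\mathrm{LD}}$ defined by $$J_{\mathrm{LD}}(x_1,\ldots,x_h):=\sup_{(\theta_1,\ldots,\theta_h)\in\mathbb{R}^h}\left\{\sum_{i=1}^h\theta_ix_i-\Upsilon(\theta_1,\ldots,\theta_h)\right\}\quad\text{for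 all }(x_1,\ldots,x_h)\in\mathbb{R}^h.$$
   Context: Inverse stable subordinator: for $\nu\in(0,1)$, the stable subordinator of order $\nu$ is the nondecreasing Lévy process $\{S_\nu(t)\}_{t\ge0}$ with $\mathbb{E}[e^{-\lambda S_\nu(t)}]=e^{-t\lambda^\nu}$ for $\lambda\ge 0$; its inverse is $L^\nu(t):=\inf\{s\geq 0:S_\nu(s)>t\}$. The functions $\kappa_{S_i}$ take values in $(-\infty,+\infty]$, with the convention $(+\infty)^{1/\nu}=+\infty$. Large deviation principle (LDP): a speed function is a real-valued function $v_t$ with $v_t\to\infty$ as $t\to\infty$; a rate function is a lower semicontinuous function $I:\mathbb{R}^h\to[0,\infty]$. A family $\{Z(t):t>0\}$ of $\mathbb{R}^h$-valued random variables satisfies the LDP with speed $v_t$ and rate function $I$ if $\limsup_{t\to\infty}\frac{1}{v_t}\log P(Z(t)\in C)\leq-\inf_{x\in C}I(x)$ for all closed $C\subseteq\mathbb{R}^h$ and $\liminf_{t\to\infty}\frac{1}{v_t}\log P(Z(t)\in O)\geq-\inf_{x\in O}I(x)$ for all open $O\subseteq\mathbb{R}^h$. Essentially smooth: a function $\Lambda:\mathbb{R}^h\to(-\infty,\infty]$ with $\mathcal{D}(\Lambda):=\{\theta:\Lambda(\theta)<\infty\}$ is essentially smooth if the interior of $\mathcal{D}(\Lambda)$ is non-empty, $\Lambda$ is differentiable throughout this interior, and $\|\nabla\Lambda(\theta_n)\|\to\infty$ whenever $(\theta_n)$ is a sequence in the interior of $\mathcal{D}(\Lambda)$ converging to a boundary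 point of $\mathcal{D}(\Lambda)$. *)

(* Defs.v *)
From HB Require Import structures.
From mathcomp Require Import all_boot all_order all_algebra.
From mathcomp Require Import all_classical all_reals all_analysis.

Set Implicit Arguments.
Unset Strict Implicit.
Unset Printing Implicit Defensive.

Import Order.TTheory GRing.Theory Num.Theory.
Import numFieldNormedType.Exports.

Local Open Scope classical_set_scope.
Local Open Scope ring_scope.

(* A real-valued process indexed by t >= 0 is a map [X : R -> {RV P >-> R}];
   its values at negative times are never constrained nor used. *)

Section processes.
Context d (Omega : measurableType d) (R : realType) (P : probability Omega R).

Definition mutually_independent (I : finType) (F : I -> set (set Omega)) :=
  forall (J : {set I}) (A : I -> set Omega),
    (forall i, i \in J -> F i (A i)) ->
    (P (\bigcap_(i in [set` J]) A i) = \prod_(i in J) P (A i))%E.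

Definition sigma_of_rv (Y : Omega -> R) : set (set Omega) :=
  preimage_set_system setT Y measurable.

Definition sigma_of_process (X : R -> {RV P >-> R}) : set (set Omega) :=
  <<s \bigcup_(t in [set t : R | 0 <= t]) sigma_of_rv (X t) >>.

Definition independent_processes (I : finType) (X : I -> R -> {RV P >-> R}) :=
  mutually_independent (fun i => sigma_of_process (X i)).

(* Every path is cadlag, so that X evaluated at a random time is measurable.
   Stochastic continuity is not listed: it follows from the other clauses. *)
Record is_levy_process (X : R -> {RV P >-> R}) : Prop := IsLevyProcess {
  levy_start : {ae P, forall w, X 0 w = 0} ;
  levy_indep_increments : forall (n : nat) (t : nat -> R),
    0 <= t 0%N -> (forall i, (i < n)%N -> t i <= t i.+1) ->
    mutually_independent
      (fun i : 'I_n => sigma_of_rv (fun w => X (t i.+1) w - X (t i) w)) ;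
  levy_stationary_increments : forall (s t : R) (B : set R),
    0 <= s -> 0 <= t -> measurable B ->
    P [set w | B (X (s + t) w - X s w)] = P [set w | B (X t w - X 0 w)] ;
  levy_right_continuous : forall w (t : R), 0 <= t ->
    X s w @[s --> t^'+] --> X t w ;
  levy_left_limits : forall w (t : R), 0 < t ->
    cvg (X s w @[s --> t^'-]) }.

Record is_stable_subordinator (nu : R) (X : R -> {RV P >-> R}) : Prop :=
  IsStableSubordinator {
  stable_levy : is_levy_process X ;
  stable_nondecreasing : forall w (s t : R),
    0 <= s -> s <= t -> X s w <= X t w ;
  stable_laplace : forall t lambda : R, 0 <= t -> 0 <= lambda ->
    ('E_P[fun w => expR (- lambda * X t w)]
      = (expR (- t * lambda `^ nu))%:E)%E }.

(* [inf] is real-valued, with inf set0 = 0; the set below is nonempty for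
   almost every w, since a stable subordinator tends to infinity a.s. *)
Definition is_inverse_stable_subordinator (nu : R) (L : R -> {RV P >-> R}) :=
  exists X : R -> {RV P >-> R}, is_stable_subordinator nu X /\
    forall (t : R) w, 0 <= t -> L t w = inf [set s | 0 <= s /\ t < X s w].

Definition kappa (X : R -> {RV P >-> R}) (theta : R) : \bar R :=
  lne ('M_P (X 1) theta).

End processes.

Section essentially_smooth.
Context (R : realType) (h : nat).

Definition gradient (f : 'rV[R]_h -> R) (x : 'rV[R]_h) : 'rV[R]_h :=
  \row_i 'D_(delta_mx 0 i) f x.

Definition domain (Lam : 'rV[R]_h -> \bar R) : set 'rV[R]_h :=
  [set theta | (Lam theta < +oo)%E].

Definition boundary (A : set 'rV[R]_h) : set 'rV[R]_h := closure A `\` A°.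

(* [`|_|] is the sup norm on row vectors. *)
Record essentially_smooth (Lam : 'rV[R]_h -> \bar R) : Prop :=
  EssentiallySmooth {
  es_interior : (domain Lam)° !=set0 ;
  es_differentiable : forall theta, (domain Lam)° theta ->
    differentiable (fine \o Lam) theta ;
  es_steep : forall (u : nat -> 'rV[R]_h) (theta : 'rV[R]_h),
    (forall n, (domain Lam)° (u n)) ->
    boundary (domain Lam) theta -> u @ \oo --> theta ->
    `|gradient (fine \o Lam) (u n)| @[n --> \oo] --> +oo }.

End essentially_smooth.

Section large_deviations.
Context d (Omega : measurableType d) (R : realType) (P : probability Omega R).
Context (h : nat).

Definition is_random_vector (Y : Omega -> 'rV[R]_h) :=
  forall B : set 'rV[R]_h, <<s open >> B -> measurable (Y @^-1` B).

Definition is_rate_function (I : 'rV[R]_h -> \bar R) :=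
  lower_semicontinuous I /\ forall x, (0 <= I x)%E.

Record satisfies_LDP (Z : R -> Omega -> 'rV[R]_h) (v : R -> R)
    (I : 'rV[R]_h -> \bar R) : Prop := SatisfiesLDP {
  ldp_random_vector : forall t, 0 < t -> is_random_vector (Z t) ;
  ldp_speed : v t @[t --> +oo] --> +oo ;
  ldp_rate : is_rate_function I ;
  ldp_upper : forall C : set 'rV[R]_h, closed C ->
    (limf_esup (fun t : R => (v t)^-1%:E * lne (P (Z t @^-1` C))) +oo%R
      <= - ereal_inf (I @` C))%E ;
  ldp_lower : forall O : set 'rV[R]_h, open O ->
    (- ereal_inf (I @` O)
      <= limf_einf (fun t : R => (v t)^-1%:E * lne (P (Z t @^-1` O))) +oo%R)%E
  }.

End large_deviations.

Section model.
Context d (Omega : measurableType d) (R : realType) (P : probability Omega R).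
Context (h k : nat) (c : 'I_h -> 'I_k -> R) (nu : R).
Context (S : 'I_h -> R -> {RV P >-> R}) (L : 'I_k -> R -> {RV P >-> R}).

Definition Upsilon (theta : 'rV[R]_h) : \bar R :=
  (\sum_(j < k)
     let s := \sum_(i < h) (c i j)%:E * kappa (S i) (theta 0%R i) in
     if 0 <= s then s `^ nu^-1 else 0)%E.

Definition J_LD (x : 'rV[R]_h) : \bar R :=
  ereal_sup [set ((\sum_(i < h) theta 0 i * x 0 i)%:E - Upsilon theta)%E
            | theta in [set: 'rV[R]_h]].

Definition scaled_time_changed (t : R) (w : Omega) : 'rV[R]_h :=
  \row_i (S i (\sum_(j < k) c i j * L j t w) w / t).

Definition all_processes (i : 'I_h + 'I_k) : R -> {RV P >-> R} :=
  match i with inl i => S i | inr j => L j end.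

End model.

(* Main.v *)
(* For [theta] with finite cumulants, conditioning on the clocks [L_j] turns the
   moment generating function of the vector at time [t] into
   [\prod_j E exp (a_j L_j(t))] with [a_j = \sum_i c_ij kappa_i(theta_i)], and
   [E exp (a L(t))] grows like [exp (t (a^+)^(1/nu))]: the upper bound follows from
   [P (L(t) > s) <= P (X(s) <= t) <= exp (lam t - s lam^nu)], the lower bound from an
   exponential change of measure for the subordinator [X].  Conditioning is carried
   out on clocks rounded up to a grid, where it is a finite-product identity for
   independent variables; refining the grid and using right continuity of the
   paths, Fatou's lemma gives the upper bound on the whole domain of [Upsilon], and
   uniform integrability the lower bound in its interior.

   The large deviation principle is then the Gartner-Ellis theorem.  Its lower
   bound is obtained without relative interiors: if the Legendre transform [I] is
   finite at [x], maximise [<theta, x> - Lam theta - eps/2 |theta|^2].  Lower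
   semicontinuity gives a maximiser, steepness forces it into the interior of the
   domain, hence [x_eps = x - eps theta] is the gradient of [Lam] at [theta], and
   [x_eps --> x] with [I x_eps <= I x]. *)

Require Import Defs.
From mathcomp Require Import all_boot all_order all_algebra.
From mathcomp Require Import all_classical all_reals all_analysis.
From mathcomp Require Import measurable_realfun ring lra.

Set Implicit Arguments.
Unset Strict Implicit.
Unset Printing Implicit Defensive.

Import Order.TTheory GRing.Theory Num.Theory.
Import numFieldNormedType.Exports.

Local Open Scope classical_set_scope.
Local Open Scope ring_scope.

(** * Independence and Levy processes *)

Section independence.
Context d (Omega : measurableType d) (R : realType) (P : probability Omega R).

Import HBNNSimple.

(** The two halves of the Gartner-Ellis theorem make unequal demands. The lower bound needs the
    growth rate from below only at an exposing [theta], which steepness places in the interior. The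
    upper bound needs the rate from above wherever the supremum defining the rate function may be
    nearly attained, hence on the whole domain. This decides how the limit along the grid is taken:
    Fatou works up to the boundary, while convergence from below asks for a moment of order [p > 1],
    that is, finite cumulants at [p *: theta], which openness provides. Rounding is strictly upwards
    because paths are only right continuous; it also makes the clocks countably valued, so that
    conditioning becomes independence on each level set. [Upsilon] is finite exactly where all
    cumulants are, the weights being positive and cumulants never [-oo]. Tilting is done by
    inequalities between integrals, without constructing the tilted measure; one lemma serves the
    subordinator in dimension one and the vector in dimension [h]. *)

Lemma integral_mul_nnsfun_comp (f : Omega -> R) (g : Omega -> \bar R)
    (phi : {nnsfun R >-> R}) :
  measurable_fun setT f -> measurable_fun setT g -> (forall w, (0 <= g w)%E) ->
  (forall B : set R, measurable B ->
    \int[P]_(w in f @^-1` B) g w = P (f @^-1` B) * \int[P]_w g w)%E ->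
  (\int[P]_w ((phi (f w))%:E * g w) =
   (\int[P]_w (phi (f w))%:E) * \int[P]_w g w)%E.
Proof.
move=> mf mg g0 H.
have mpre (r : R) : measurable (f @^-1` (phi @^-1` [set r])).
  by rewrite -[X in measurable X]setTI; exact: mf.
have m1 (r : R) : measurable_fun setT
    (fun w => (r * \1_(phi @^-1` [set r]) (f w))%:E).
  apply/measurable_EFinP; apply: measurable_funM => //.
  by apply: (measurableT_comp _ mf); exact: measurable_indic.
have p1 (r : R) (w : Omega) : (0 <= (r * \1_(phi @^-1` [set r]) (f w))%:E)%E.
  exact: nnfun_muleindic_ge0.
have E1 : (\int[P]_w ((phi (f w))%:E * g w) =
  \sum_(r \in range phi) \int[P]_w ((r * \1_(phi @^-1` [set r]) (f w))%:E * g w))%E.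
  rewrite -ge0_integral_fsum//=.
  - apply: eq_integral => w _.
    rewrite -ge0_mule_fsuml// fsumEFin//.
    by rewrite -fimfunE.
  - by move=> r; exact: emeasurable_funM.
  - by move=> r w _; rewrite mule_ge0.
have E2 : (\int[P]_w (phi (f w))%:E =
  \sum_(r \in range phi) \int[P]_w (r * \1_(phi @^-1` [set r]) (f w))%:E)%E.
  rewrite -ge0_integral_fsum//=.
  by apply: eq_integral => w _; rewrite fsumEFin// -fimfunE.
rewrite E1 E2 ge0_mule_fsuml; last by move=> r; apply: integral_ge0.
apply: eq_fsbigr => r /[!inE] -[x _ xr].
have r0 : 0 <= r by rewrite -xr.
have ind w : \1_(phi @^-1` [set r]) (f w) =
    \1_(f @^-1` (phi @^-1` [set r])) w :> R by [].
under eq_integral do rewrite EFinM -muleA ind.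
rewrite ge0_integralZl//; last 2 first.
  - by apply: emeasurable_funM => //; apply/measurable_EFinP; exact: measurable_indic.
  - by move=> w _; rewrite mule_ge0// lee_fin.
under [in RHS]eq_integral do rewrite EFinM ind.
rewrite ge0_integralZl//; last by apply/measurable_EFinP; exact: measurable_indic.
rewrite integral_indic// setIT -muleA -H; last by [].
congr (_ * _)%E.
rewrite [RHS]integral_mkcond; apply: eq_integral => w _.
rewrite epatch_indic/= muleC//.
Qed.

Lemma integral_mul_indep (f g : Omega -> R) :
  measurable_fun setT f -> (forall w, 0 <= f w) ->
  measurable_fun setT g -> (forall w, 0 <= g w) ->
  (forall B : set R, measurable B ->
    \int[P]_(w in f @^-1` B) (g w)%:E = P (f @^-1` B) * \int[P]_w (g w)%:E)%E ->
  (\int[P]_w (f w * g w)%:E = (\int[P]_w (f w)%:E) * \int[P]_w (g w)%:E)%E.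
Proof.
move=> mf f0 mg g0 H.
(* Simple approximation needs a nonnegative function on [R]; the absolute value agrees with the
   identity on the values of [f]. *)
have mabs : measurable_fun setT (fun x : R => `|x|%:E).
  by apply/measurable_EFinP; exact: normr_measurable.
pose phi := nnsfun_approx measurableT mabs.
have cphi w : ((phi n (f w))%:E @[n --> \oo] --> (f w)%:E)%E.
  rewrite -[in X in _ --> X](ger0_norm (f0 w)).
  by apply: (cvg_nnsfun_approx measurableT mabs) => // x _; rewrite lee_fin.
have ndphi w n m : (n <= m)%N -> phi n (f w) <= phi m (f w).
  by move=> nm; exact/lefP/nd_nnsfun_approx.
have mphi n : measurable_fun setT (fun w => phi n (f w)).
  exact: (measurableT_comp _ mf).
have L1 : (\int[P]_w (phi n (f w) * g w)%:E @[n --> \oo] -->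
           \int[P]_w (f w * g w)%:E)%E.
  have -> : (\int[P]_w (f w * g w)%:E =
     \int[P]_w (limn (fun n => (phi n (f w) * g w)%:E)))%E.
    apply: eq_integral => w _; apply/esym/cvg_lim => //.
    by under eq_fun do rewrite EFinM; rewrite EFinM; exact: cvgeZr.
  apply: cvg_monotone_convergence => //.
  - by move=> n; apply/measurable_EFinP; exact: measurable_funM.
  - by move=> n w _; rewrite lee_fin mulr_ge0.
  - by move=> w _ n m nm; rewrite lee_fin ler_wpM2r// ndphi.
have L2 : (\int[P]_w (phi n (f w))%:E @[n --> \oo] --> \int[P]_w (f w)%:E)%E.
  have -> : (\int[P]_w (f w)%:E = \int[P]_w (limn (fun n => (phi n (f w))%:E)))%E.
    by apply: eq_integral => w _; apply/esym/cvg_lim.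
  apply: cvg_monotone_convergence => //.
  - by move=> n; apply/measurable_EFinP.
  - by move=> n w _; rewrite lee_fin.
  - by move=> w _ n m nm; rewrite lee_fin ndphi.
have phile n w : phi n (f w) <= f w.
  rewrite nnsfun_approxE -lee_fin -[in leRHS](ger0_norm (f0 w)).
  by apply: le_approx => // x _; rewrite lee_fin.
have eqn n : (\int[P]_w (phi n (f w) * g w)%:E =
    (\int[P]_w (phi n (f w))%:E) * \int[P]_w (g w)%:E)%E.
  under eq_integral do rewrite EFinM.
  by rewrite (@integral_mul_nnsfun_comp f (EFin \o g))//; exact/measurable_EFinP.
have le1 n : (\int[P]_w (phi n (f w))%:E <= \int[P]_w (f w)%:E)%E.
  apply: ge0_le_integral => //.
  - by move=> w _; rewrite lee_fin.
  - exact/measurable_EFinP.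
  - exact/measurable_EFinP.
  - by move=> w _; rewrite lee_fin.
have le2 n : (\int[P]_w (phi n (f w) * g w)%:E <= \int[P]_w (f w * g w)%:E)%E.
  apply: ge0_le_integral => //.
  - by move=> w _; rewrite lee_fin mulr_ge0.
  - by apply/measurable_EFinP; exact: measurable_funM.
  - by apply/measurable_EFinP; exact: measurable_funM.
  - by move=> w _; rewrite lee_fin ler_wpM2r.
have : (0 <= \int[P]_w (g w)%:E)%E by apply: integral_ge0 => w _; rewrite lee_fin.
case E : (\int[P]_w (g w)%:E)%E => [r| |//] r0.
  rewrite -(cvg_lim _ L1)//; apply: cvg_lim => //.
  by rewrite (eq_cvg _ _ eqn) E; exact: cvgeZr.
(* Here [g] has infinite integral, and multiplication by [+oo] is not continuous at 0. Either all
   approximants of [f] have integral 0, or one of them has a positive integral and already forces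
   the left-hand side to be infinite. *)
have [f00|f00] := eqVneq (\int[P]_w (f w)%:E)%E 0%E.
  rewrite f00 mul0e -(cvg_lim _ L1)//; apply: cvg_lim => //.
  rewrite (eq_cvg _ _ eqn) (_ : (fun n => _) = cst 0%E); first exact: cvg_cst.
  apply/funext => n; rewrite (_ : \int[P]_w _ = 0)%E ?mul0e//.
  apply/eqP; rewrite eq_le -{1}f00 le1/=.
  by apply: integral_ge0 => w _; rewrite lee_fin.
have fgt0 : (0 < \int[P]_w (f w)%:E)%E.
  by rewrite lt0e f00; apply: integral_ge0 => w _; rewrite lee_fin.
rewrite gt0_muley//.
have [n] : exists n, (0 < \int[P]_w (phi n (f w))%:E)%E.
  apply: contrapT => /forallNP n0; move: fgt0; rewrite ltNge => /negP; apply.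
  apply: (cvge_to_le L2); apply: nearW => n.
  by rewrite leNgt; exact/negP.
move=> n0; apply/eqP; rewrite -leye_eq; apply: le_trans (le2 n).
by rewrite eqn E gt0_muley.
Qed.

(** The events indexed by [K] are what makes the induction on [s] work: to split off [f i], its
    level event is moved into [K], and the induction hypothesis then yields the factorisation that
    [integral_mul_indep] asks for. *)
Lemma integral_bigcap_prod_indep (I : finType) (F : I -> set (set Omega))
    (f : I -> Omega -> R) :
  mutually_independent P F -> (forall i A, F i A -> measurable A) ->
  (forall i w, 0 <= f i w) ->
  (forall i B, measurable B -> F i (f i @^-1` B)) ->
  forall (s : seq I) (K : {set I}) (A : I -> set Omega),
    uniq s -> {in s, forall i, i \notin K} -> {in K, forall i, F i (A i)} ->
  (\int[P]_(w in \bigcap_(i in [set` K]) A i) (\prod_(i <- s) f i w)%:E =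
   P (\bigcap_(i in [set` K]) A i) * \prod_(i <- s) \int[P]_w (f i w)%:E)%E.
Proof.
move=> indep mF f0 Ff.
have mf i : measurable_fun setT (f i).
  by move=> _ B mB; rewrite setTI; exact/mF/Ff.
elim=> [|i s IH] K A /=.
  move=> _ _ FA; under eq_integral do rewrite big_nil.
  rewrite big_nil mule1 integral_cst ?mul1e//.
  by apply: fin_bigcap_measurable => // i iK; exact/mF/FA.
move=> /andP[iNs us] sK FA.
have iNK : i \notin K by apply: sK; rewrite mem_head.
set D := \bigcap_(j in _) A j.
have mD : measurable D.
  by apply: fin_bigcap_measurable => // j jK; exact/mF/FA.
have sK' : {in s, forall j, j \notin K}.
  by move=> j js; apply: sK; rewrite inE js orbT.
pose g w := \prod_(j <- s) f j w * \1_D w.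
have mg : measurable_fun setT g.
  by apply: measurable_funM => //; exact: measurable_prod.
have g0 w : 0 <= g w by rewrite mulr_ge0// prodr_ge0.
have gE (E : set Omega) : (\int[P]_(w in E) (g w)%:E =
    \int[P]_(w in E `&` D) (\prod_(j <- s) f j w)%:E)%E.
  rewrite [RHS]integral_mkcondr; apply: eq_integral => w _.
  by rewrite epatch_indic/= -EFinM.
have -> : (\int[P]_(w in D) (\prod_(j <- i :: s) f j w)%:E =
           \int[P]_w (f i w * g w)%:E)%E.
  rewrite [LHS]integral_mkcond; apply: eq_integral => w _.
  by rewrite epatch_indic/= -EFinM big_cons mulrA.
rewrite integral_mul_indep//.
  by rewrite gE setTI IH// big_cons muleCA.
move=> B mB; rewrite !gE setTI.
pose A' j := if j == i then f i @^-1` B else A j.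
have AA' j : j \in K -> A' j = A j.
  by move=> jK; rewrite /A'; case: eqP => // ji; rewrite -ji jK in iNK.
have DE : f i @^-1` B `&` D = \bigcap_(j in [set` i |: K]) A' j.
  apply/seteqP; split=> [w [fB Dw] j|w H].
    rewrite /= in_setU1 => /orP[/eqP ->|jK]; first by rewrite /A' eqxx.
    by rewrite AA'//; exact: Dw.
  split; first by have := H i; rewrite /A' eqxx; apply; rewrite /= setU11.
  by move=> j jK; rewrite -AA'//; apply: H; rewrite /= setU1r.
have FA' : {in i |: K, forall j, F j (A' j)}.
  move=> j; rewrite in_setU1 => /orP[/eqP ->|jK]; first by rewrite /A' eqxx; exact: Ff.
  by rewrite AA'//; exact: FA.
rewrite DE IH//; last first.
  move=> j js; rewrite in_setU1 negb_or sK'// andbT.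
  by apply: contraNneq iNs => <-.
rewrite IH// muleA; congr (_ * _)%E.
rewrite indep// indep// big_setU1//= {1}/A' eqxx; congr (_ * _)%E.
by apply: eq_bigr => j jK; rewrite AA'.
Qed.

Lemma integral_prod_indep (I : finType) (F : I -> set (set Omega))
    (f : I -> Omega -> R) :
  mutually_independent P F -> (forall i A, F i A -> measurable A) ->
  (forall i w, 0 <= f i w) ->
  (forall i B, measurable B -> F i (f i @^-1` B)) ->
  (\int[P]_w (\prod_i f i w)%:E = \prod_i \int[P]_w (f i w)%:E)%E.
Proof.
move=> indep mF f0 Ff.
have := @integral_bigcap_prod_indep _ _ _ indep mF f0 Ff
  (index_enum I) finset.set0 (fun=> setT) (index_enum_uniq I).
have -> : [set` finset.set0] = set0 :> set I.
  by apply/seteqP; split=> // i; rewrite /= inE.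
rewrite bigcap_set0 probability_setT mul1e; apply.
- by move=> i _; rewrite inE.
- by move=> i; rewrite inE.
Qed.

End independence.

(** * Rounding times strictly upwards to a grid *)

Section upper_grid.
Context {R : realType}.

(* Strictly above [x], so that right continuity applies along the grid. *)
Definition upper_grid n (x : R) : R := (Num.truncn (x * n.+1%:R)).+1%:R / n.+1%:R.

Lemma upper_grid_gt n x : x < upper_grid n x.
Proof. by rewrite /upper_grid ltr_pdivlMr// truncnS_gt. Qed.

Lemma upper_grid_le n x : 0 <= x -> upper_grid n x <= x + n.+1%:R^-1.
Proof.
move=> x0; rewrite /upper_grid ler_pdivrMr// mulrDl mulVf// -natr1 lerD2r.
by have /truncn_itv/andP[] : 0 <= x * n.+1%:R by rewrite mulr_ge0.
Qed.

Lemma cvg_upper_grid x : 0 <= x -> upper_grid n x @[n --> \oo] --> x.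
Proof.
move=> x0; apply: (@squeeze_cvgr _ _ _ _ (fun n => x) (fun n => x + n.+1%:R^-1)).
- by apply: nearW => n; rewrite ltW ?upper_grid_gt//= upper_grid_le.
- exact: cvg_cst.
- by rewrite -[X in _ --> X]addr0; apply: cvgD; [exact: cvg_cst|exact: cvg_harmonic].
Qed.

End upper_grid.

(** * Moment generating functions of Levy processes *)

Section levy_mgf.
Context d (Omega : measurableType d) (R : realType) (P : probability Omega R).

Lemma fatou_cvg (f_ : nat -> Omega -> R) (f : Omega -> R) (l_ : nat -> \bar R)
    (l : \bar R) :
  (forall n, measurable_fun setT (f_ n)) -> (forall n w, 0 <= f_ n w) ->
  (forall w, f_ n w @[n --> \oo] --> f w) ->
  (forall n, \int[P]_w (f_ n w)%:E <= l_ n)%E -> l_ n @[n --> \oo] --> l ->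
  (\int[P]_w (f w)%:E <= l)%E.
Proof.
move=> mf f0 cf fl cl.
have -> : (\int[P]_w (f w)%:E = \int[P]_w limn_einf (fun n => (f_ n w)%:E))%E.
  apply: eq_integral => w _; rewrite (cvg_limn_einf_sup (l := (f w)%:E))//.
  by apply: cvg_EFin; [exact: nearW|exact: cf].
apply: (le_trans (fatou _ _ _ _)) => //.
- by move=> n; exact/measurable_EFinP.
- by move=> n w _; rewrite lee_fin.
rewrite limn_einf_lim -(cvg_lim _ cl)//; apply: lee_lim.
- exact: is_cvg_einfs.
- exact: cvgP cl.
- apply: nearW => n; apply: le_trans (fl n).
  by apply: ereal_inf_lbound; exists n => /=.
Qed.

Variable X : R -> {RV P >-> R}.
Hypothesis levyX : is_levy_process X.
Variable theta : R.

Let M s := (\int[P]_w (expR (theta * (X s w - X 0 w)))%:E)%E.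

Let mincr s t : measurable_fun setT (fun w => expR (theta * (X t w - X s w))).
Proof.
apply: measurableT_comp => //; apply: measurable_funM => //.
exact: measurable_funB.
Qed.

Lemma levy_mgf_incr s t : 0 <= s -> 0 <= t ->
  (\int[P]_w (expR (theta * (X (s + t) w - X s w)))%:E = M t)%E.
Proof.
move=> s0 t0.
pose Y1 : {RV P >-> R} := (X (s + t) \- X s)%R.
pose Y2 : {RV P >-> R} := (X t \- X 0)%R.
have mexp : measurable_fun setT (fun y : R => (expR (theta * y))%:E).
  by apply/measurable_EFinP; apply: measurableT_comp => //; exact: mulrl_measurable.
have := @ge0_integral_distribution _ _ _ _ _ P Y1 _ mexp.
rewrite /= => <-; last by move=> y; rewrite lee_fin expR_ge0.
have := @ge0_integral_distribution _ _ _ _ _ P Y2 _ mexp.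
rewrite /M /= => <-; last by move=> y; rewrite lee_fin expR_ge0.
apply: eq_measure_integral => B mB _.
exact: (levy_stationary_increments levyX).
Qed.

Lemma levy_mgfD s t : 0 <= s -> 0 <= t -> (M (s + t) = M s * M t)%E.
Proof.
move=> s0 t0.
pose tt n := nth 0 [:: 0; s; s + t] n.
have indep : mutually_independent P
    (fun i : 'I_2 => sigma_of_rv (fun w => X (tt i.+1) w - X (tt i) w)).
  apply: (levy_indep_increments levyX (t := tt)) => //.
  by case=> [|[|//]] _; rewrite /tt/= ?lerDl.
have -> : M (s + t) = (\int[P]_w (\prod_(i < 2)
   expR (theta * (X (tt i.+1) w - X (tt i) w)))%:E)%E.
  apply: eq_integral => w _; rewrite !big_ord_recl big_ord0 /= mulr1 /tt/=.
  by rewrite -expRD; congr (expR _)%:E; ring.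
have mexp : measurable_fun setT (fun y : R => expR (theta * y)).
  by apply: measurableT_comp => //; exact: mulrl_measurable.
rewrite (integral_prod_indep indep).
- by rewrite !big_ord_recl big_ord0 /= mule1 /tt/= levy_mgf_incr.
- move=> i A [B mB <-]; apply: (measurable_funB _ _ measurableT) => //.
- by move=> i w; exact: expR_ge0.
- move=> i B mB; exists ((fun y => expR (theta * y)) @^-1` B).
    by rewrite -[X in measurable X]setTI; exact: mexp.
  by rewrite setTI.
Qed.

Lemma levy_mgfX s n : 0 <= s -> (M (n%:R * s) = M s ^+ n)%E.
Proof.
move=> s0; elim: n => [|n IH].
  rewrite mul0r expe0 /M; under eq_integral do rewrite subrr mulr0 expR0.
  by rewrite integral_cst// mul1e; exact: probability_setT.
by rewrite -natr1 mulrDl mul1r addrC levy_mgfD ?mulr_ge0// IH expeS.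
Qed.

Lemma levy_mgf0 s : (\int[P]_w (expR (theta * X s w))%:E = M s)%E.
Proof.
apply: ge0_ae_eq_integral => //.
- apply/measurable_EFinP; apply: measurableT_comp => //; exact: measurable_funM.
- exact/measurable_EFinP.
have [N [mN N0 XN]] := levy_start levyX.
exists N; split=> // w /= Nw; apply: XN => /= X0; apply: Nw => _.
by rewrite X0 subr0.
Qed.

Hypothesis kappa_fin : kappa X theta \is a fin_num.
Let a := fine (kappa X theta).

Let M_ge0 s : (0 <= M s)%E.
Proof. by apply: integral_ge0 => w _; rewrite lee_fin expR_ge0. Qed.

Lemma levy_mgf1 : M 1 = (expR a)%:E.
Proof.
have : kappa X theta = lne (M 1).
  rewrite /kappa /mmt_gen_fun unlock -levy_mgf0; congr lne.
  by apply: eq_integral => w _; rewrite /= mulrC.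
rewrite /a; move: kappa_fin => /[swap] ->; move: (M_ge0 1).
case: (M 1) => [r| |]//=.
rewrite lee_fin le_eqVlt => /orP[/eqP <-|r0]; first by rewrite lexx.
by rewrite leNgt r0/= => _; rewrite lnK.
Qed.

(** [M q.+1%:R^-1] is the nonnegative root of order [q.+1] of [M 1]; the value [+oo] is excluded
    because its powers are infinite. *)
Lemma levy_mgf_rat p q : M (p%:R / q.+1%:R) = (expR (p%:R / q.+1%:R * a))%:E.
Proof.
have H : M q.+1%:R^-1 = (expR (q.+1%:R^-1 * a))%:E.
  have := levy_mgf1; rewrite -[X in M X](@mulfV _ q.+1%:R)// levy_mgfX//.
  move: (M_ge0 q.+1%:R^-1); case: (M q.+1%:R^-1) => [r r0| _|//].
    rewrite -EFin_expe => -[H]; congr EFin; apply/eqP.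
    rewrite -(@eqrXn2 _ q.+1)// ?expR_ge0// H -expRM_natl.
    by rewrite mulrA divff// mul1r.
  have -> // : (+oo ^+ q.+1 = +oo :> \bar R)%E.
  by elim: (q) => [|k IH]; rewrite expeS ?expe0 ?mule1// IH mulyy.
by rewrite levy_mgfX// H -EFin_expe -expRM_natl mulrA.
Qed.

(** Right continuity along rational times decreasing to [s]; Fatou's lemma retains only an
    inequality. *)
Lemma levy_mgf_le s : 0 <= s -> (M s <= (expR (s * a))%:E)%E.
Proof.
move=> s0; have cs := cvg_upper_grid s0.
apply: (fatou_cvg (f_ := fun n w => expR (theta * (X (upper_grid n s) w - X 0 w)))
  (l_ := fun n => (expR (upper_grid n s * a))%:E)) => //.
- move=> w; apply: continuous_cvg; first exact: continuous_expR.
  apply: cvgMr; apply: cvgB; last exact: cvg_cst.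
  have /cvg_at_rightP := @levy_right_continuous _ _ _ _ _ levyX w s s0; apply; split=> // n.
  exact: upper_grid_gt.
- by move=> n; rewrite /upper_grid -levy_mgf_rat.
- apply: cvg_EFin; first exact: nearW.
  apply: continuous_cvg; first exact: continuous_expR.
  exact: cvgMl.
Qed.

(** [upper_grid 0 s] is an integer above [s], where [M] is known exactly. There [M] factors over the
    times [upper_grid 0 s - s] and [s]; each factor is bounded above by its exponential and the
    product attains the bound, so neither inequality is strict. *)
Lemma levy_mgf s : 0 <= s ->
  (\int[P]_w (expR (theta * X s w))%:E = (expR (s * a))%:E)%E.
Proof.
move=> s0; rewrite levy_mgf0; apply/eqP; rewrite eq_le levy_mgf_le//=.
have u0 : 0 <= upper_grid 0 s - s by rewrite subr_ge0 ltW// upper_grid_gt.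
have := @levy_mgf_rat (Num.truncn (s * 1)).+1 0.
rewrite -/(upper_grid 0 s) -[in M _](subrK s (upper_grid 0 s)) levy_mgfD//.
have := levy_mgf_le u0; have := levy_mgf_le s0; move: (M_ge0 s).
move: (M_ge0 (upper_grid 0 s - s)).
case: (M s) => [y| |]//; case: (M (_ - _)) => [x| |]//.
rewrite !lee_fin => x0 y0 ys xs [xy].
have : expR ((upper_grid 0 s - s) * a) * expR (s * a) <=
    expR ((upper_grid 0 s - s) * a) * y.
  by rewrite -expRD -mulrDl subrK -xy ler_wpM2r.
by rewrite ler_pM2l ?expR_gt0.
Qed.

End levy_mgf.

(** * Exponential rates and exponential change of measure *)

Section exponential_rates.
Context {R : realType}.
Implicit Types (f g : R -> \bar R) (a b : R).

(* [limsup (1/t) log f t <= a], stated without logarithms since [f] may vanish. *)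
Definition exp_rate_le f a := forall e : R, 0 < e ->
  \forall t \near +oo, (f t <= (expR (t * (a + e)))%:E)%E.

Definition exp_rate_ge f a := forall e : R, 0 < e ->
  \forall t \near +oo, ((expR (t * (a - e)))%:E <= f t)%E.

Lemma near_pinfty_gt0 : \forall t \near +oo, (0 : R) < t.
Proof. exact: nbhs_pinfty_gt. Qed.

Lemma exp_rate_leW f a b : a <= b -> exp_rate_le f a -> exp_rate_le f b.
Proof.
move=> ab fa e e0; near=> t; have t0 : 0 < t by near: t; exact: near_pinfty_gt0.
apply: (@le_trans _ _ (expR (t * (a + e)))%:E); first by near: t; exact: fa.
by rewrite lee_fin ler_expR ler_pM2l// lerD2r.
Unshelve. all: by end_near. Qed.

Lemma exp_rate_geW f a b : a <= b -> exp_rate_ge f b -> exp_rate_ge f a.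
Proof.
move=> ab fa e e0; near=> t; have t0 : 0 < t by near: t; exact: near_pinfty_gt0.
apply: (@le_trans _ _ (expR (t * (b - e)))%:E); last by near: t; exact: fa.
by rewrite lee_fin ler_expR ler_pM2l// lerD2r.
Unshelve. all: by end_near. Qed.

Lemma exp_rate_le_le f g a : (\forall t \near +oo, (f t <= g t)%E) ->
  exp_rate_le g a -> exp_rate_le f a.
Proof. by move=> fg ga e /ga; apply: filterS2 fg => t; exact: le_trans. Qed.

Lemma exp_rate_ge_ge f g a : (\forall t \near +oo, (f t <= g t)%E) ->
  exp_rate_ge f a -> exp_rate_ge g a.
Proof. by move=> fg fa e /fa; apply: filterS2 fg => t /[swap]; exact: le_trans. Qed.

Lemma exp_rate_leM f a b : exp_rate_le f a ->
  exp_rate_le (fun t => (expR (t * b))%:E * f t)%E (b + a).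
Proof.
move=> fa e /fa; apply: filterS => t ft.
by rewrite -addrA mulrDr expRD EFinM lee_wpmul2l// lee_fin expR_ge0.
Qed.

Lemma exp_rate_geM f a b : exp_rate_ge f a ->
  exp_rate_ge (fun t => (expR (t * b))%:E * f t)%E (b + a).
Proof.
move=> fa e /fa; apply: filterS => t ft.
by rewrite -addrA mulrDr expRD EFinM lee_wpmul2l// lee_fin expR_ge0.
Qed.

Lemma exp_rate_le_cst (c : R) : 0 <= c -> exp_rate_le (fun=> c%:E) 0.
Proof.
move=> c0 e e0; near=> t; rewrite lee_fin add0r.
apply: (le_trans _ (expR_ge1Dx _)); rewrite -[leLHS]add0r lerD//.
by rewrite -ler_pdivrMr//; near: t; exact: nbhs_pinfty_ge.
Unshelve. all: by end_near. Qed.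

Lemma exp_rate_leD f g a : exp_rate_le f a -> exp_rate_le g a ->
  exp_rate_le (fun t => f t + g t)%E a.
Proof.
move=> fa ga e e0; have e20 : 0 < e / 2 by rewrite divr_gt0.
near=> t.
apply: (@le_trans _ _ (2%:E * (expR (t * (a + e / 2)))%:E)%E).
  rewrite -EFinM mulr_natl mulr2n EFinD leeD//.
    by near: t; exact: fa.
  by near: t; exact: ga.
have -> : t * (a + e) = t * (e / 2) + t * (a + e / 2) by field.
rewrite expRD EFinM lee_wpmul2r ?lee_fin ?expR_ge0//.
rewrite -[e / 2]add0r -lee_fin; near: t; apply: exp_rate_le_cst => //.
Unshelve. all: by end_near. Qed.

Lemma exp_rate_le0 a : exp_rate_le (cst 0%E) a.
Proof. by move=> e e0; apply: nearW => t; rewrite lee_fin expR_ge0. Qed.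

Lemma exp_rate_le_sum (I : eqType) (s : seq I) (F : I -> R -> \bar R) a :
  {in s, forall i, exp_rate_le (F i) a} ->
  exp_rate_le (fun t => \sum_(i <- s) F i t)%E a.
Proof.
elim: s => [|i s IH] Fa.
  by under eq_fun do rewrite big_nil; exact: exp_rate_le0.
under eq_fun do rewrite big_cons.
apply: exp_rate_leD; first by apply: Fa; rewrite mem_head.
by apply: IH => j js; apply: Fa; rewrite inE js orbT.
Qed.

Lemma exp_rate_ge_sub f g k a b : b < a -> exp_rate_ge f a -> exp_rate_le g b ->
  (\forall t \near +oo, (f t <= k t + g t)%E) -> exp_rate_ge k a.
Proof.
move=> ba fa gb fkg e e0.
(* The bound [(a - b) / 4] gives [b + e1 <= a - 2 * e1], and [e / 2] gives [a - e <= a - 2 * e1].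
   Since [expR (t * e1) >= 2] eventually, [expR (t * (a - e1))] exceeds twice
   [expR (t * (a - 2 * e1))]: one copy absorbs [g], the other remains. *)
pose e1 := Num.min (e / 2) ((a - b) / 4).
have e10 : 0 < e1 by rewrite lt_min !divr_gt0// subr_gt0.
have e1e : e1 <= e / 2 by rewrite ge_min lexx.
have e1ab : e1 <= (a - b) / 4 by rewrite ge_min lexx orbT.
near=> t; have t0 : 0 < t by near: t; exact: near_pinfty_gt0.
have h1 : ((expR (t * (a - e1)))%:E <= f t)%E by near: t; exact: fa.
have h2 : (g t <= (expR (t * (b + e1)))%:E)%E by near: t; exact: gb.
have h3 : (f t <= k t + g t)%E by near: t.
have h4 : (expR (t * (a - e1)) <= fine (expR (t * (a - e1)))%:E)%R by [].
have two : 2 <= expR (t * e1).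
  rewrite -lee_fin -[e1]add0r; near: t.
  exact: (@exp_rate_le_cst 2 _ e1).
have le1 : expR (t * (a - e)) <= expR (t * (a - e1)) - expR (t * (b + e1)).
  have -> : t * (a - e1) = t * e1 + t * (a - 2 * e1) by ring.
  rewrite expRD.
  have A : expR (t * (a - e)) <= expR (t * (a - 2 * e1)).
    by rewrite ler_expR ler_pM2l//; lra.
  have B : expR (t * (b + e1)) <= expR (t * (a - 2 * e1)).
    by rewrite ler_expR ler_pM2l//; lra.
  have := ler_wpM2r (expR_ge0 (t * (a - 2 * e1))) two.
  lra.
apply: (@le_trans _ _ (expR (t * (a - e1)) - expR (t * (b + e1)))%:E).
  by rewrite lee_fin.
rewrite EFinB leeBlDr//; apply: (le_trans h1); apply: (le_trans h3).
exact: leeD2l.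
Unshelve. all: by end_near. Qed.

Lemma limf_esup_rate_le (p : R -> \bar R) (l : R) :
  exp_rate_le p l ->
  (limf_esup (fun t : R => t^-1%:E * lne (p t)) +oo%R <= l%:E)%E.
Proof.
move=> pl; apply/lee_addgt0Pr => e e0; rewrite limf_esupE.
pose V := [set t : R | 0 < t /\ (p t <= (expR (t * (l + e)))%:E)%E].
have FV : (+oo%R : set_system R) V by apply: filterS2 near_pinfty_gt0 (pl _ e0).
apply: (@le_trans _ _ (ereal_sup ((fun t => t^-1%:E * lne (p t))%E @` V))).
  by apply: ereal_inf_lbound; exists V.
apply: ge_ereal_sup => _ [t [t0 pt] <-].
rewrite lee_pdivrMl//.
rewrite -EFinM -[leRHS](@expeRK R).
have [p0|p0] := leP (p t) 0%E; first by rewrite le0_lneNy// leNye.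
by rewrite lee_lne ?in_itv/= ?leey ?andbT// ltW.
Qed.

Lemma limf_einf_rate_ge (p : R -> \bar R) (l : R) :
  exp_rate_ge p l ->
  (l%:E <= limf_einf (fun t : R => t^-1%:E * lne (p t)) +oo%R)%E.
Proof.
move=> pl; apply/lee_subgt0Pr => e e0; rewrite limf_einfE.
pose V := [set t : R | 0 < t /\ ((expR (t * (l - e)))%:E <= p t)%E].
have FV : (+oo%R : set_system R) V by apply: filterS2 near_pinfty_gt0 (pl _ e0).
apply: (@le_trans _ _ (ereal_inf ((fun t => t^-1%:E * lne (p t))%E @` V))); last first.
  by apply: ereal_sup_ubound; exists V.
apply: le_ereal_inf_tmp => _ [t [t0 pt] <-].
rewrite lee_pdivlMl//.
rewrite -EFinB -EFinM -[leLHS](@expeRK R).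
rewrite lee_lne ?in_itv/= ?leey ?andbT//.
by apply: le_trans pt; rewrite lee_fin expR_ge0.
Qed.

End exponential_rates.

Lemma exp_rate_ge_approx {R : realType} (f : R -> \bar R) (a : R) :
  (forall e, 0 < e -> exp_rate_ge f (a - e)) -> exp_rate_ge f a.
Proof.
move=> H e e0; have e20 : 0 < e / 2 by rewrite divr_gt0.
by have := H _ e20 _ e20; rewrite -addrA -opprD -splitr.
Qed.

Lemma exp_rate_le_approx {R : realType} (f : R -> \bar R) (a : R) :
  (forall e, 0 < e -> exp_rate_le f (a + e)) -> exp_rate_le f a.
Proof.
move=> H e e0; have e20 : 0 < e / 2 by rewrite divr_gt0.
by have := H _ e20 _ e20; rewrite -addrA -splitr.
Qed.

(** * Scalar product and sup norm on row vectors *)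

Definition dot {R : realType} {h : nat} (x y : 'rV[R]_h) : R :=
  \sum_(i < h) x 0 i * y 0 i.

Section dot_theory.
Context {R : realType} {h : nat}.
Implicit Types x y z : 'rV[R]_h.

Lemma dotC x y : dot x y = dot y x.
Proof. by apply: eq_bigr => i _; rewrite mulrC. Qed.

Lemma dotDl x y z : dot (x + y) z = dot x z + dot y z.
Proof. by rewrite -big_split; apply: eq_bigr => i _; rewrite mxE mulrDl. Qed.

Lemma dotZl (a : R) x y : dot (a *: x) y = a * dot x y.
Proof. by rewrite mulr_sumr; apply: eq_bigr => i _; rewrite mxE mulrA. Qed.

Lemma dotDr x y z : dot x (y + z) = dot x y + dot x z.
Proof. by rewrite !(dotC x) dotDl. Qed.

Lemma dotZr (a : R) x y : dot x (a *: y) = a * dot x y.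
Proof. by rewrite !(dotC x) dotZl. Qed.

Lemma dotNr x y : dot x (- y) = - dot x y.
Proof. by rewrite -scaleN1r dotZr mulN1r. Qed.

Lemma dot_delta (i : 'I_h) y : dot (delta_mx 0 i) y = y 0 i.
Proof.
rewrite /dot (bigD1 i)//= mxE !eqxx mul1r big1 ?addr0// => j ji.
by rewrite mxE (negbTE ji) mul0r.
Qed.

Lemma le_coord_norm x i : `|x 0 i| <= `|x|.
Proof.
rewrite [leRHS]/Num.Def.normr/= mx_normrE.
by apply/bigmax_geP; right; exists (0, i).
Qed.

Lemma norm_le_coord x (r : R) : 0 <= r -> (forall i, `|x 0 i| <= r) -> `|x| <= r.
Proof.
move=> r0 xr; rewrite [leLHS]/Num.Def.normr/= mx_normrE.
by apply/bigmax_leP; split=> // -[i j] _; rewrite ord1.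
Qed.

Lemma le_dot_norm x y : `|dot x y| <= `|y| * \sum_(i < h) `|x 0 i|.
Proof.
rewrite mulr_sumr; apply: (le_trans (ler_norm_sum _ _ _)).
apply: ler_sum => i _; rewrite normrM mulrC ler_wpM2r//.
exact: le_coord_norm.
Qed.

Lemma continuous_dot y : continuous (fun z : 'rV[R]_h => dot y z).
Proof.
move=> z; have Fz : Filter (nbhs z) by exact: nbhs_filter.
apply: (@cvg_big _ _ _ _ _ add_continuous _ (nbhs z)) => i _.
by apply: cvgMr; exact: coord_continuous.
Qed.

Lemma norm_scaled_sign_delta (r : R) (b : bool) (i : 'I_h) : 0 <= r ->
  `|(r * (-1) ^+ b) *: delta_mx 0 i : 'rV[R]_h| <= r.
Proof.
move=> r0; apply: norm_le_coord => // j.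
rewrite !mxE eqxx /= !normrM normr_sign mulr1 ger0_norm//.
by rewrite ler_piMr//; case: (j == _); rewrite ?normr1 ?normr0.
Qed.

Lemma interior0_closed_ball (A : set 'rV[R]_h) : A° 0 ->
  exists2 r : R, 0 < r & forall x, `|x| <= r -> A x.
Proof.
move=> /nbhs_ballP[r /= r0 Hr]; exists (r / 2); first by rewrite divr_gt0.
move=> x xr; apply: Hr; rewrite -ball_normE /= sub0r normrN.
by apply: le_lt_trans xr _; rewrite ltr_pdivrMr// ltr_pMr// ltr1n.
Qed.

Lemma compact_norm_le (rho : R) : compact [set y : 'rV[R]_h | `|y| <= rho].
Proof.
apply: bounded_closed_compact.
  by exists rho; split=> [|M rM y /= yr]; [exact: num_real|exact: le_trans yr (ltW rM)].
have -> : [set y : 'rV[R]_h | `|y| <= rho] =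
    closed_ball_ (fun y : 'rV[R]_h => `|y|) 0 rho.
  by apply/seteqP; split=> y /=; rewrite /closed_ball_/= sub0r normrN.
exact: closed_closed_ball_.
Qed.

End dot_theory.

Lemma lt_normr_sign (R : realDomainType) (r x : R) : r < `|x| ->
  exists b : bool, r < (-1) ^+ b * x.
Proof.
rewrite ltr_normr => /orP[rx|rx]; first by exists false; rewrite mul1r.
by exists true; rewrite mulN1r.
Qed.

(** * Lower bounds by exponential tilting *)

Section tilting.
Context d (Omega : measurableType d) (R : realType) (P : probability Omega R).
Context (h : nat) (Z : R -> Omega -> 'rV[R]_h).

(** For [Z t] a vector divided by [t], the factor [t] restores the moment generating function of the
    undivided vector; its exponential rate is the limiting cumulant function. *)
Definition mgf (theta : 'rV[R]_h) (t : R) : \bar R :=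
  (\int[P]_w (expR (t * dot theta (Z t w)))%:E)%E.

Hypothesis mZ : forall t i, 0 < t -> measurable_fun setT (fun w => Z t w 0 i).

Lemma measurable_expR_dot theta t : 0 < t ->
  measurable_fun setT (fun w => expR (t * dot theta (Z t w))).
Proof.
move=> t0; apply: measurableT_comp => //; apply: measurable_funM => //.
apply: measurable_sum => i; apply: measurable_funM => //.
exact: mZ.
Qed.

Definition box (y : 'rV[R]_h) (r : R) (t : R) : set Omega :=
  [set w | forall i, `|Z t w 0 i - y 0 i| <= r].

Lemma measurable_box y r t : 0 < t -> measurable (box y r t).
Proof.
move=> t0; have -> : box y r t =
    \bigcap_(i in [set: 'I_h]) [set w | `|Z t w 0 i - y 0 i| <= r].
  by apply/seteqP; split=> w H i; [move=> _; exact: H|exact: H].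
apply: fin_bigcap_measurable => // i _.
rewrite -[X in measurable X]setTI; apply: measurable_fun_le => //.
apply: (measurableT_comp (@normr_measurable R setT)).
by apply: measurable_funB => //; exact: mZ.
Qed.

Lemma box_subset y r r' t : r <= r' -> box y r t `<=` box y r' t.
Proof. by move=> rr' w H i; apply: le_trans (H i) rr'. Qed.

Variables (Lam : 'rV[R]_h -> R) (theta y : 'rV[R]_h).
Hypothesis lower : exp_rate_ge (mgf theta) (Lam theta).
Hypothesis upper : \forall eta \near theta, exp_rate_le (mgf eta) (Lam eta).
Hypothesis grad : forall i, is_derive theta (delta_mx 0 i) Lam (y 0 i).

Let dir (p : 'I_h * bool) : 'rV[R]_h := (-1) ^+ p.2 *: delta_mx 0 p.1.

(** First-order expansion along the signed basis vectors, with slack [r]; being finitely many, they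
    share one step [s]. Signs are absorbed into the increment of the difference quotient, which may
    be negative. *)
Let directional_bound (r : R) : 0 < r -> exists2 s, 0 < s &
  forall p, exp_rate_le (mgf (theta + s *: dir p)) (Lam (theta + s *: dir p)) /\
    Lam (theta + s *: dir p) <= Lam theta + s * ((-1) ^+ p.2 * y 0 p.1 + r).
Proof.
move=> r0.
suff : \forall s \near 0^'+, forall p : 'I_h * bool,
    exp_rate_le (mgf (theta + s *: dir p)) (Lam (theta + s *: dir p)) /\
    Lam (theta + s *: dir p) <= Lam theta + s * ((-1) ^+ p.2 * y 0 p.1 + r).
  move=> H; have [s [s0 Hs]] := filter_ex (filterI (nbhs_right_gt (0 : R)) H).
  by exists s.
apply: filter_forall => -[i b].
have cdir : theta + s *: dir (i, b) @[s --> (0 : R)^'+] --> theta.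
  rewrite -[X in _ --> X]addr0; apply: cvgD; first exact: cvg_cst.
  rewrite -[X in _ --> X](scale0r (dir (i, b))); apply: cvgZr_tmp.
  exact: cvg_at_right_filter.
have H1 := cdir _ upper.
have H2 : \forall s \near (0 : R)^'+,
    Lam (theta + s *: dir (i, b)) <= Lam theta + s * ((-1) ^+ b * y 0 i + r).
  have Hcvg : q^-1 *: ((Lam \o shift theta) (q *: delta_mx 0 i) - Lam theta)
      @[q --> (0 : R)^'] --> y 0 i.
    rewrite -(@derive_val _ _ _ _ _ _ _ (grad i)).
    exact: (@ex_derive _ _ _ _ _ _ _ (grad i)).
  have /cvgrPdist_le /(_ r r0)[rho /= rho0 Hrho] := Hcvg.
  near=> s; have s0 : 0 < s by near: s; exact: nbhs_right_gt.
  have srho : s < rho by near: s; exact: nbhs_right_lt.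
  have sg0 : (-1) ^+ b * s != 0 by rewrite mulf_neq0 ?signr_eq0// gt_eqF.
  have := Hrho ((-1) ^+ b * s) _ sg0.
  rewrite /= sub0r normrN normrM normr_sign mul1r gtr0_norm// => /(_ srho).
  rewrite [X in Lam X]addrC /dir scalerA (mulrC s).
  set D := Lam _ - Lam theta; rewrite -lerBlDl.
  rewrite -[Lam _ - _]/D invfM invr_sign => HD.
  have -> : D = s * ((-1) ^+ b * ((-1) ^+ b * s^-1 *: D)).
    rewrite /GRing.scale /= !mulrA -(mulrA s) -signr_addb addbb expr0 mulr1.
    by rewrite divff ?gt_eqF// mul1r.
  rewrite ler_pM2l//; move: HD; set E := _ *: D.
  by rewrite ler_norml => /andP[]; case: (b); rewrite ?expr1 ?expr0; lra.
by near=> s; split; near: s; [exact: H1|exact: H2].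
Unshelve. all: by end_near. Qed.


(* Under the measure tilted by [theta], Chernoff bounds in the directions
   [+- e_i] confine [Z t] to a small box around the gradient [y]. *)
Lemma tilted_lower_bound (r : R) : 0 < r ->
  exp_rate_ge (fun t => P (box y r t)) (Lam theta - dot theta y).
Proof.
move=> r0 e e0.
(* [C] is the dual norm of [theta]: on the box of size [r'], [dot theta (Z t w)] exceeds
   [dot theta y] by at most [r' * C <= e / 2]. Using [C + 1] keeps the denominator positive. *)
pose C := \sum_(i < h) `|theta 0 i|.
have C0 : 0 <= C by apply: sumr_ge0.
pose r' := Num.min r (e / (2 * (C + 1))).
have r'0 : 0 < r' by rewrite lt_min r0/= divr_gt0// mulr_gt0// ltr_wpDl.
have r'C : r' * C <= e / 2.
  apply: (@le_trans _ _ (e / (2 * (C + 1)) * (C + 1))).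
    by apply: ler_pM => //; [exact: ltW|rewrite ge_min lexx orbT|rewrite lerDl].
  by rewrite invfM mulrA mulfVK// gt_eqF// ltr_wpDl.
have r'20 : 0 < r' / 2 by rewrite divr_gt0.
have [s s0 Hs] := directional_bound r'20.
(* Outside the box some signed coordinate exceeds that of [y] by more than [r'], so adding
   [s *: dir p] to [theta] raises the exponent by at least the compensating factor. The slack
   [r' / 2] in the expansion leaves a rate smaller than [Lam theta] by [s * (r' / 2)], so these
   terms are negligible. *)
pose bad t := (\sum_(p : 'I_h * bool)
  (expR (t * - (s * ((-1) ^+ p.2 * y 0 p.1 + r'))))%:E * mgf (theta + s *: dir p) t)%E.
have bad_rate : exp_rate_le bad (Lam theta - s * (r' / 2)).
  apply: exp_rate_le_sum => p _; have [Hp1 Hp2] := Hs p.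
  apply: (@exp_rate_leW _ _ (- (s * ((-1) ^+ p.2 * y 0 p.1 + r')) +
     Lam (theta + s *: dir p))); last exact: exp_rate_leM.
  lra.
pose c := dot theta y + r' * C.
have main : \forall t \near +oo,
    (mgf theta t <= (expR (t * c))%:E * P (box y r' t) + bad t)%E.
  apply: filterS near_pinfty_gt0 => t t0.
  have pointwise w : ((expR (t * dot theta (Z t w)))%:E <=
      (expR (t * c))%:E * (\1_(box y r' t) w)%:E + \sum_(p : 'I_h * bool)
      (expR (t * - (s * ((-1) ^+ p.2 * y 0 p.1 + r'))))%:E *
      (expR (t * dot (theta + s *: dir p) (Z t w)))%:E)%E.
    have term0 (p : 'I_h * bool) : (0 <= (expR (t * - (s * ((-1) ^+ p.2 * y 0 p.1 + r'))))%:E *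
      (expR (t * dot (theta + s *: dir p) (Z t w)))%:E)%E.
      by rewrite -EFinM lee_fin mulr_ge0 ?expR_ge0.
    have [wB|wB] := pselect (box y r' t w).
      rewrite indicE mem_set// mule1 -[leLHS]adde0 leeD//; last exact: sume_ge0.
      rewrite lee_fin ler_expR ler_pM2l//.
      have -> : Z t w = y + (Z t w - y) by rewrite addrC subrK.
      rewrite dotDr lerD2l; apply: (le_trans (ler_norm _)).
      apply: (le_trans (le_dot_norm _ _)); rewrite ler_wpM2r//.
      by apply: norm_le_coord => [|i]; [exact: ltW|rewrite !mxE; exact: wB].
    have [i wi] : exists i, r' < `|Z t w 0 i - y 0 i|.
      apply: contrapT => /forallNP H; apply: wB => i.
      by rewrite leNgt; exact/negP.
    have [b wb] := lt_normr_sign wi.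
    rewrite -[leLHS]add0e leeD ?mule_ge0 ?lee_fin ?expR_ge0//.
    rewrite (bigD1 (i, b))//= -[leLHS]adde0 leeD ?sume_ge0//.
    rewrite -EFinM -expRD lee_fin ler_expR -mulrDr ler_pM2l//.
    rewrite dotDl !dotZl dot_delta; nra.
  have mE eta : measurable_fun setT (fun w => (expR (t * dot eta (Z t w)))%:E).
    by apply/measurable_EFinP; exact: measurable_expR_dot.
  have mB := measurable_box y r' t0.
  have -> : bad t = (\int[P]_w (\sum_(p : 'I_h * bool)
      (expR (t * - (s * ((-1) ^+ p.2 * y 0 p.1 + r'))))%:E *
      (expR (t * dot (theta + s *: dir p) (Z t w)))%:E))%E.
    rewrite ge0_integral_sum//.
    - by apply: eq_bigr => p _; rewrite ge0_integralZl_EFin ?expR_ge0.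
    - by move=> p; apply: emeasurable_funM.
  have -> : ((expR (t * c))%:E * P (box y r' t) =
      \int[P]_w ((expR (t * c))%:E * (\1_(box y r' t) w)%:E))%E.
    rewrite ge0_integralZl_EFin ?expR_ge0// ?integral_indic ?setIT//.
    by apply/measurable_EFinP.
  rewrite -ge0_integralD//.
  - apply: ge0_le_integral => //.
    apply: emeasurable_funD; first by apply: emeasurable_funM => //; exact/measurable_EFinP.
    by apply: emeasurable_sum => p; apply: emeasurable_funM.
  - by apply: emeasurable_funM => //; exact/measurable_EFinP.
  - by move=> w _; apply: sume_ge0 => p _; rewrite -EFinM lee_fin mulr_ge0 ?expR_ge0.
  - by apply: emeasurable_sum => p; apply: emeasurable_funM.
have good : exp_rate_ge (fun t => (expR (t * c))%:E * P (box y r' t))%E (Lam theta).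
  apply: (exp_rate_ge_sub _ lower bad_rate main).
  by rewrite ltrBlDr ltrDl mulr_gt0.
have e20 : 0 < e / 2 by rewrite divr_gt0.
have := @exp_rate_geM _ _ _ (- c) good _ e20.
apply: filterS2 near_pinfty_gt0 => t t0.
rewrite muleA -EFinM -expRD -mulrDr addNr mulr0 expR0 mul1e => H.
apply: (@le_trans _ _ (P (box y r' t))); last first.
  apply: le_measure; rewrite ?inE; [exact: measurable_box..|].
  by apply: box_subset; rewrite ge_min lexx.
apply: le_trans H; rewrite lee_fin ler_expR ler_pM2l// /c; lra.
Qed.

End tilting.

(** * Inverse stable subordinators *)

Lemma measure_le_integral d (Omega : measurableType d) (R : realType)
    (P : probability Omega R) (A : set Omega) (f : Omega -> R) :
  measurable A -> measurable_fun setT f -> (forall w, 0 <= f w) ->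
  (forall w, A w -> 1 <= f w) -> (P A <= \int[P]_w (f w)%:E)%E.
Proof.
move=> mA mf f0 Af.
rewrite -[X in P X](setIT A) -integral_indic//.
apply: ge0_le_integral => //.
- exact/measurable_EFinP.
- exact/measurable_EFinP.
move=> w _; rewrite lee_fin indicE; case: (boolP (w \in A)) => //= wA.
by apply: Af; rewrite inE in wA.
Qed.

Lemma is_derive_coord (R : realType) (h : nat) (g : R -> R) (x : 'rV[R]_h)
    (i : 'I_h) (y : R) :
  is_derive (x 0 i) 1 g y -> is_derive x (delta_mx 0 i) (fun z => g (z 0 i)) y.
Proof.
move=> [dg gy].
have E : (fun q : R => q^-1 *: (((fun z : 'rV[R]_h => g (z 0 i)) \o shift x)
      (q *: delta_mx 0 i) - g (x 0 i))) =
    (fun q : R => q^-1 *: ((g \o shift (x 0 i)) (q *: 1) - g (x 0 i))).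
  by apply/funext => q /=; rewrite !mxE !eqxx.
split; first by rewrite /derivable E.
by rewrite /derive E.
Qed.

Section inverse_stable_subordinator.
Context d (Omega : measurableType d) (R : realType) (P : probability Omega R).
Context (nu : R) (nu_gt0 : 0 < nu) (nu_lt1 : nu < 1).
Context (X L : R -> {RV P >-> R}).
Hypothesis stableX : is_stable_subordinator nu X.
Hypothesis LX : forall (t : R) w, 0 <= t -> L t w = inf [set s | 0 <= s /\ t < X s w].

Let mexpX (a b s : R) : measurable_fun setT (fun w => expR (a + b * X s w)).
Proof.
by apply: measurableT_comp => //; apply: measurable_funD => //; exact: measurable_funM.
Qed.

Let mexpL (b t : R) : measurable_fun setT (fun w => expR (b * L t w)).
Proof. by apply: measurableT_comp => //; exact: measurable_funM. Qed.

Lemma inverse_stable_ge0 (t : R) w : 0 <= t -> 0 <= L t w.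
Proof.
move=> t0; rewrite LX//.
have [->|ne] := eqVneq [set s | 0 <= s /\ t < X s w] set0; first by rewrite inf0.
by apply: lb_le_inf; [exact/set0P|move=> s []].
Qed.

Lemma stable_laplace_integral (s lam : R) : 0 <= s -> 0 <= lam ->
  (\int[P]_w (expR (- lam * X s w))%:E = (expR (- s * lam `^ nu))%:E)%E.
Proof. by move=> s0 l0; rewrite -(stable_laplace stableX)// unlock. Qed.

Let measurable_XE (s t : R) : measurable [set w | X s w <= t].
Proof.
by rewrite -[X in measurable X]setTI; exact: measurable_fun_le.
Qed.

Let measurable_LE (s t : R) : measurable [set w | s < L t w].
Proof.
have -> : [set w | s < L t w] = ~` [set w | L t w <= s].
  by apply/seteqP; split=> w /=; rewrite ltNge => /negP.
apply: measurableC; rewrite -[X in measurable X]setTI; exact: measurable_fun_le.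
Qed.

Lemma stable_chernoff (s t lam : R) : 0 <= s -> 0 <= lam ->
  (P [set w | (X s w <= t)%R] <= (expR (lam * t - s * lam `^ nu))%:E)%E.
Proof.
move=> s0 l0.
apply: (@le_trans _ _ (\int[P]_w (expR (lam * t + - lam * X s w))%:E)%E).
  apply: measure_le_integral => //.
  by move=> w /= Xt; rewrite -expR0 ler_expR mulNr subr_ge0 ler_wpM2l.
under eq_integral do rewrite expRD EFinM.
rewrite ge0_integralZl_EFin ?expR_ge0//.
- by rewrite stable_laplace_integral// -EFinM -expRD mulNr.
- apply/measurable_EFinP; apply: measurableT_comp => //; exact: measurable_funM.
Qed.

Lemma inverse_stable_gt_subset (s t : R) : 0 <= s -> 0 <= t ->
  [set w | s < L t w] `<=` [set w | X s w <= t].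
Proof.
move=> s0 t0 w /=; rewrite LX// !leNgt => /negP sL; apply/negP => tX; apply: sL.
by apply/negP; rewrite -leNgt; apply: ge_inf; [exists 0 => q []|].
Qed.

Lemma inverse_stable_tail (s t lam : R) : 0 <= s -> 0 <= t -> 0 <= lam ->
  (P [set w | (s < L t w)%R] <= (expR (lam * t - s * lam `^ nu))%:E)%E.
Proof.
move=> s0 t0 l0; apply: le_trans (stable_chernoff t s0 l0).
by apply: le_measure; rewrite ?inE//; exact: inverse_stable_gt_subset.
Qed.

Lemma inverse_stable_ge (s t : R) : 0 <= s -> 0 <= t ->
  (P [set w | (X s w <= t)%R] <= P [set w | (s <= L t w)%R])%E.
Proof.
move=> s0 t0.
(* The set defining [L t w] can be empty only on [N], and there [inf] has the default value 0. The
   Chernoff bound with exponent 1, [exp (t - n)], makes [N] null. *)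
pose N := \bigcap_n [set w | X n%:R w <= t].
have mN : measurable N by exact: bigcapT_measurable.
have PN : P N = 0%E.
  apply/eqP; rewrite eq_le measure_ge0 andbT; apply/lee_addgt0Pr => e e0.
  rewrite add0e.
  pose n := (Num.truncn (t - ln e)).+1.
  apply: (@le_trans _ _ (P [set w | X n%:R w <= t])).
    by apply: le_measure; rewrite ?inE// => w; apply.
  apply: (le_trans (@stable_chernoff n%:R t 1 _ _)) => //.
  rewrite lee_fin powR1 mul1r mulr1 -[leRHS]lnK ?posrE// ler_expR.
  by rewrite lerBlDr -lerBlDl ltW// truncnS_gt.
have mLge : measurable [set w | s <= L t w].
  by rewrite -[X in measurable X]setTI; exact: measurable_fun_le.
rewrite -[leRHS]adde0 -PN; apply: le_trans (measureU2 _ _ _) => //.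
apply: le_measure; rewrite ?inE//; first exact: measurableU.
move=> w /= Xs; have [Nw|Nw] := pselect (N w); [by right|left].
have [n /negP nN] : exists n : nat, ~ (X n%:R w <= t).
  by apply: contrapT => /forallNP H; apply: Nw => n _; exact: contrapT (H n).
rewrite LX//; apply: lb_le_inf.
  by exists n%:R; split=> //; rewrite ltNge.
move=> q [q0 tq]; rewrite leNgt; apply/negP => qs.
have := stable_nondecreasing stableX w q0 (ltW qs).
by move=> /le_trans /(_ Xs); rewrite leNgt tq.
Qed.

Definition inverse_stable_rate (a : R) : R := Num.max a 0 `^ nu^-1.

Lemma inverse_stable_rate_le0 a : a <= 0 -> inverse_stable_rate a = 0.
Proof. by move=> a0; rewrite /inverse_stable_rate max_r// powR0// invr_neq0// gt_eqF. Qed.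

Lemma inverse_stable_rateK a : 0 <= a -> inverse_stable_rate a `^ nu = a.
Proof.
by move=> a0; rewrite /inverse_stable_rate max_l// -powRrM mulVf ?gt_eqF// powRr1.
Qed.

(** Slicing the values of [L t] into unit intervals: the slice above [n] contributes at most
    [exp (a (n + 1))] times a tail [exp (lam t - n lam^nu)], a geometric series of ratio
    [exp (a - lam^nu)]. The summand 1 accounts for [L t = 0]. *)
Lemma mgf_inverse_stable_le (a lam t : R) : 0 <= a -> 0 <= lam -> 0 <= t -> a < lam `^ nu ->
  (\int[P]_w (expR (a * L t w))%:E <=
   (1 + expR (t * lam) * (expR a / (1 - expR (a - lam `^ nu))))%:E)%E.
Proof.
move=> a0 l0 t0 al.
set q := expR (a - lam `^ nu).
have q1 : q < 1 by rewrite -expR0 ltr_expR subr_lt0.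
pose f n w := (expR (a * n.+1%:R) * \1_[set w | n%:R < L t w] w)%:E.
have f0 n w : (0 <= f n w)%E by rewrite lee_fin mulr_ge0 ?expR_ge0.
have mf n : measurable_fun setT (f n).
  by apply/measurable_EFinP; apply: measurable_funM => //; exact: measurable_indic.
have le_f w : ((expR (a * L t w))%:E <= 1 + \sum_(n <oo) f n w)%E.
  have L0 := inverse_stable_ge0 w t0.
  have [Lle0|Lgt0] := leP (L t w) 0.
    rewrite (_ : L t w = 0) ?mulr0 ?expR0; last by apply/eqP; rewrite eq_le Lle0.
    by rewrite leeDl// nneseries_ge0.
  (* The slices are open on the left to match the strict tail event, so an integer value of [L t w]
     belongs to the slice below it. *)
  have [n /andP[nL Ln]] : exists n : nat, n%:R < L t w <= n.+1%:R.
    have /truncn_itv/andP[h1 h2] := L0.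
    move: h1; rewrite le_eqVlt => /orP[/eqP h1|h1]; last first.
      by exists (Num.truncn (L t w)); rewrite h1 ltW.
    case E : (Num.truncn (L t w)) => [|m]; first by rewrite -h1 E ltxx in Lgt0.
    by exists m; rewrite -{1}h1 E ltr_nat ltnSn/= -h1 E.
  apply: (@le_trans _ _ (f n w)).
    by rewrite /f indicE mem_set//= mulr1 lee_fin ler_expR ler_wpM2l.
  rewrite -[leLHS]add0e leeD//.
  apply: (@le_trans _ _ (\sum_(0 <= i < n.+1) f i w)%E).
    by rewrite big_nat_recr//= leeDr// sume_ge0.
  exact: nneseries_lim_ge.
apply: (@le_trans _ _ (\int[P]_w (1 + \sum_(n <oo) f n w))%E).
  apply: ge0_le_integral => //.
  - exact/measurable_EFinP.
  - by apply: emeasurable_funD => //; exact: ge0_emeasurable_sum.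
rewrite ge0_integralD//; last 2 first.
- by move=> w _; exact: nneseries_ge0.
- exact: ge0_emeasurable_sum.
rewrite integral_cst// mul1e [X in (X + _)%E]probability_setT EFinD leeD//.
rewrite integral_nneseries//.
apply: lime_le; first by apply: is_cvg_nneseries => n _ _; exact: integral_ge0.
apply: nearW => N.
apply: (@le_trans _ _ (\sum_(0 <= n < N) (geometric (expR (t * lam) * expR a) q n)%:E)%E).
  apply: lee_sum => n _.
  rewrite /f; under eq_integral do rewrite EFinM.
  rewrite ge0_integralZl_EFin ?expR_ge0//; last by apply/measurable_EFinP; exact: measurable_indic.
  rewrite integral_indic// setIT.
  apply: (@le_trans _ _ ((expR (a * n.+1%:R))%:E * (expR (lam * t - n%:R * lam `^ nu))%:E)%E).
    by rewrite lee_wpmul2l ?lee_fin ?expR_ge0//; exact: inverse_stable_tail.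
  rewrite -EFinM lee_fin /geometric/= /q -expRM_natl -!expRD ler_expR -natr1; lra.
rewrite sumEFin lee_fin mulrA; apply: geometric_le_lim.
- by rewrite mulr_ge0 ?expR_ge0.
- exact: expR_gt0.
- by rewrite gtr0_norm ?expR_gt0.
Qed.

Lemma mgf_inverse_stable_fin (a t : R) : 0 <= t ->
  exists m, (\int[P]_w (expR (a * L t w))%:E = m%:E)%E.
Proof.
move=> t0; pose lam := inverse_stable_rate `|a| + 1.
have r0 : 0 <= inverse_stable_rate `|a| by exact: powR_ge0.
have lam0 : 0 <= lam by rewrite addr_ge0.
have alam : `|a| < lam `^ nu.
  by rewrite -{1}(inverse_stable_rateK (normr_ge0 a)) gt0_ltr_powR ?nnegrE ?ltrDl.
have aL : (\int[P]_w (expR (a * L t w))%:E <= \int[P]_w (expR (`|a| * L t w))%:E)%E.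
  apply: ge0_le_integral => //.
  - exact/measurable_EFinP.
  - exact/measurable_EFinP.
  - by move=> w _; rewrite lee_fin ler_expR ler_wpM2r ?ler_norm// inverse_stable_ge0.
have := le_trans aL (mgf_inverse_stable_le (normr_ge0 a) lam0 t0 alam).
have : (0 <= \int[P]_w (expR (a * L t w))%:E)%E.
  by apply: integral_ge0 => w _; rewrite lee_fin expR_ge0.
by case: (\int[P]_w _)%E => [r _ _| |//]; [exists r|rewrite leye_eq].
Qed.

Lemma mgf_inverse_stable_rate_le (a : R) :
  exp_rate_le (fun t => \int[P]_w (expR (a * L t w))%:E)%E (inverse_stable_rate a).
Proof.
have [a0|a0] := leP a 0.
  rewrite inverse_stable_rate_le0//.
  apply: exp_rate_le_le (@exp_rate_le_cst R 1 ler01).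
  apply: filterS (near_pinfty_gt0) => t t0 /=.
  rewrite -(probability_setT P) -[leRHS]mul1e -integral_cst//.
  apply: ge0_le_integral => //.
  - exact/measurable_EFinP.
  - move=> w _; rewrite lee_fin -expR0 ler_expR.
    by rewrite mulr_le0_ge0// inverse_stable_ge0// ltW.
apply: exp_rate_le_approx => e e0.
(* Just above the critical value [a^(1/nu)] the geometric constant [K] is finite and does not depend
   on [t]. *)
set lam := inverse_stable_rate a + e.
have r0 : 0 <= inverse_stable_rate a by exact: powR_ge0.
have lam0 : 0 < lam by rewrite ltr_wpDl.
have alam : a < lam `^ nu.
  rewrite -{1}(inverse_stable_rateK (ltW a0)) gt0_ltr_powR ?nnegrE ?ltrDl//.
  exact: ltW.
set K := expR a / (1 - expR (a - lam `^ nu)).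
have K0 : 0 <= K.
  by rewrite divr_ge0 ?expR_ge0// subr_ge0 -expR0 ler_expR subr_le0 ltW.
apply: (@exp_rate_le_le _ _ (fun t => (1%:E + (expR (t * lam))%:E * K%:E))%E).
  apply: filterS (near_pinfty_gt0) => t t0 /=.
  rewrite -EFinM -EFinD; apply: mgf_inverse_stable_le; rewrite ?ltW//.
apply: exp_rate_leD.
  exact: exp_rate_leW (ltW lam0) (@exp_rate_le_cst R 1 ler01).
by have := @exp_rate_leM R (fun=> K%:E) 0 lam (exp_rate_le_cst K0); rewrite addr0.
Qed.

(** This is [tilted_lower_bound] in dimension one for [X (u * t) / t], whose cumulant function is
    [- u * (- z)^nu] for [z <= 0]. At [z = - lam] its derivative, the tilted mean, is
    [u * nu * lam^(nu - 1)]; the margin [r] keeps the whole box below 1. *)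
Lemma stable_lower_rate (u lam r : R) : 0 < u -> 0 < lam -> 0 < r ->
  u * nu * lam `^ (nu - 1) + r <= 1 ->
  exp_rate_ge (fun t => P [set w | (X (u * t) w <= t)%R])
    (- u * lam `^ nu + lam * (u * nu * lam `^ (nu - 1))).
Proof.
move=> u0 l0 r0 yr1.
pose Z t w : 'rV[R]_1 := \row_(i < 1) (X (u * t) w / t).
pose Lam (z : 'rV[R]_1) := - u * (- z 0 0) `^ nu.
pose theta : 'rV[R]_1 := \row_(i < 1) (- lam).
pose y : 'rV[R]_1 := \row_(i < 1) (u * nu * lam `^ (nu - 1)).
have mZ t i : 0 < t -> measurable_fun setT (fun w => Z t w 0 i).
  by move=> t0; under eq_fun do rewrite mxE; exact: measurable_funM.
have mgfE (z : 'rV[R]_1) (t : R) : 0 < t -> z 0 0 <= 0 ->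
    mgf P Z z t = (expR (t * Lam z))%:E.
  move=> t0 z0; rewrite /mgf.
  transitivity (\int[P]_w (expR (- (- z 0 0) * X (u * t) w))%:E)%E.
    apply: eq_integral => w _; congr (expR _)%:E.
    by rewrite /dot big_ord1 mxE opprK; field; rewrite gt_eqF.
  have ut0 : 0 <= u * t by rewrite mulr_ge0// ltW.
  rewrite stable_laplace_integral ?oppr_ge0//.
  by congr (expR _)%:E; rewrite /Lam; ring.
have rate_le : forall z : 'rV[R]_1, z 0 0 <= 0 -> exp_rate_le (mgf P Z z) (Lam z).
  move=> z z0 e e0; apply: filterS near_pinfty_gt0 => t t0.
  by rewrite mgfE// lee_fin ler_expR ler_pM2l// lerDl ltW.
have H := @tilted_lower_bound _ _ _ P 1 Z mZ Lam theta y _ _ _ r r0.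
apply: exp_rate_geW (exp_rate_ge_ge _ (H _ _ _)).
- rewrite /Lam /dot big_ord1 !mxE opprK; lra.
- apply: filterS near_pinfty_gt0 => t t0.
  apply: le_measure; rewrite ?inE//; first exact: measurable_box.
  move=> w /(_ 0); rewrite !mxE ler_norml => /andP[_ H2] /=.
  have : X (u * t) w / t <= 1 by lra.
  by rewrite ler_pdivrMr// mul1r.
- move=> e e0; apply: filterS near_pinfty_gt0 => t t0.
  rewrite mgfE//; last by rewrite mxE oppr_le0 ltW.
  by rewrite lee_fin ler_expR ler_pM2l// gerBl ltW.
- have th0 : theta 0 0 < 0 by rewrite mxE oppr_lt0.
  have : \forall z \near theta, (z : 'rV[R]_1) 0 0 < 0.
    exact: (@coord_continuous R 1 1 0 0 theta) (lt_nbhsl th0).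
  by apply: filterS => z z0; apply: rate_le; exact: ltW.
- move=> i; rewrite ord1.
  apply: (@is_derive_coord _ _ (fun z => - u * (- z) `^ nu)).
  rewrite !mxE.
  have l0' : 0 < - - lam by rewrite opprK.
  have d1 := is_derive1_powR nu l0'.
  have d2 : is_derive (- lam) 1 (-%R : R -> R) (-1) by exact: is_deriveNid.
  have := is_deriveZ (- u) (is_derive1_comp d1 d2).
  rewrite opprK => d3; apply: is_derive_eq d3 _.
  by rewrite /GRing.scale/=; ring.
Qed.

(** For [a <= 0] the integrand is at least [exp (a eps t)] on the event [L t <= eps t], whose
    complement is exponentially small. *)
Lemma mgf_inverse_stable_rate_ge0 (a : R) : a <= 0 ->
  exp_rate_ge (fun t => \int[P]_w (expR (a * L t w))%:E)%E 0.
Proof.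
move=> a0; apply: exp_rate_ge_approx => e e0; rewrite sub0r.
(* Since [eps * (1 - a) = e], [a * eps >= - e]; dividing by [1 - a] rather than [- a] covers
   [a = 0]. *)
pose eps := e / (1 - a).
have a10 : 0 < 1 - a by rewrite subr_gt0 (le_lt_trans a0).
have eps0 : 0 < eps by rewrite divr_gt0.
have eeps : - e <= a * eps.
  have : eps * (1 - a) = e by rewrite mulfVK// gt_eqF.
  nra.
(* The tail exponent [lam - eps * lam^nu] vanishes when [lam^(1 - nu) = eps]; taking half of that
   value makes it equal to [- g0], which is negative. *)
pose lam := (eps / 2) `^ (1 - nu)^-1.
have n10 : 0 < 1 - nu by rewrite subr_gt0.
have lam0 : 0 < lam by rewrite powR_gt0// divr_gt0.
have eps20 : 0 < eps / 2 by rewrite divr_gt0.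
have lam1 : lam `^ (1 - nu) = eps / 2 by rewrite -powRrM mulVf ?gt_eqF// powRr1// ltW.
have lamE : lam = lam `^ nu * (eps / 2).
  rewrite -lam1 -powRD; first by rewrite addrC subrK powRr1// ltW.
  by rewrite (gt_eqF lam0) implybT.
pose g0 := lam `^ nu * (eps / 2).
have g00 : 0 < g0 by rewrite mulr_gt0 ?powR_gt0// divr_gt0.
have mle t : measurable [set w | L t w <= eps * t].
  by rewrite -[X in measurable X]setTI; exact: measurable_fun_le.
have tail : exp_rate_le (fun t => P [set w | (eps * t < L t w)%R]) (- g0).
  move=> r r0; apply: filterS near_pinfty_gt0 => t t0.
  have et0 : 0 <= eps * t by rewrite mulr_ge0// ltW.
  apply: (le_trans (@inverse_stable_tail (eps * t) t lam et0 (ltW t0) (ltW lam0))).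
  rewrite lee_fin ler_expR.
  have -> : lam * t - eps * t * lam `^ nu = t * (lam - 2 * g0) by rewrite /g0; field.
  by rewrite ler_pM2l// {1}lamE -/g0; lra.
have bulk : exp_rate_ge (fun t => P [set w | (L t w <= eps * t)%R]) 0.
  have one : exp_rate_ge (fun=> 1%E) (0 : R).
    move=> r r0; apply: filterS near_pinfty_gt0 => t t0.
    by rewrite lee_fin -expR0 ler_expR sub0r mulrN oppr_le0 mulr_ge0// ltW.
  apply: (exp_rate_ge_sub _ one tail); first by rewrite oppr_lt0.
  apply: nearW => t; rewrite -(probability_setT P).
  have -> : [set: Omega] = [set w | L t w <= eps * t] `|` [set w | eps * t < L t w].
    by apply/seteqP; split=> w //= _; case: leP => _; [left|right].
  exact: measureU2.
apply: (@exp_rate_geW _ _ _ (a * eps + 0)); first by rewrite addr0.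
apply: exp_rate_ge_ge (exp_rate_geM _ bulk).
apply: filterS near_pinfty_gt0 => t t0.
rewrite -[X in P X]setIT -integral_indic// -ge0_integralZl_EFin ?expR_ge0//; last first.
  by apply/measurable_EFinP; exact: measurable_indic.
apply: ge0_le_integral => //.
- by apply: emeasurable_funM => //; apply/measurable_EFinP; exact: measurable_indic.
- exact/measurable_EFinP.
move=> w _; rewrite indicE; case: (boolP (w \in _)) => /= wA.
  rewrite mule1 lee_fin ler_expR mulrC -mulrA ler_wnM2l//.
  by rewrite inE in wA.
by rewrite mule0 lee_fin expR_ge0.
Qed.

(** For [a > 0] only the event [u * t <= L t] is kept. Its gain [a * u] cancels the cost
    [u * lam^nu] of [stable_lower_rate], because [lam^nu = a]; what remains is [lam * (1 - r)],
    within [e] of [lam]. *)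
Lemma mgf_inverse_stable_rate_ge (a : R) :
  exp_rate_ge (fun t => \int[P]_w (expR (a * L t w))%:E)%E (inverse_stable_rate a).
Proof.
have [a0|a0] := leP a 0.
  rewrite inverse_stable_rate_le0//.
  exact: mgf_inverse_stable_rate_ge0.
set lam := inverse_stable_rate a.
have lam0 : 0 < lam by rewrite /lam /inverse_stable_rate max_l ?powR_gt0// ltW.
have lamnu : lam `^ nu = a by rewrite inverse_stable_rateK// ltW.
apply: exp_rate_ge_approx => e e0.
pose r := Num.min (2^-1) (e / lam).
have r0 : 0 < r by rewrite lt_min invr_gt0 ltr0n divr_gt0.
have r1 : r < 1 by rewrite gt_min invf_lt1// ltr1n.
have rlam : lam * r <= e.
  by rewrite mulrC -ler_pdivlMr// ge_min lexx orbT.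
have pow0 : 0 < lam `^ (nu - 1) by exact: powR_gt0.
(* The tilted mean of [X (u * t) / t] is [1 - r], just below 1. *)
pose u := (1 - r) / (nu * lam `^ (nu - 1)).
have u0 : 0 < u by rewrite divr_gt0 ?subr_gt0// mulr_gt0.
have uE : u * nu * lam `^ (nu - 1) = 1 - r.
  by rewrite -mulrA mulfVK// gt_eqF// mulr_gt0.
have := @stable_lower_rate u lam r u0 lam0 r0.
rewrite uE subrK lexx lamnu => /(_ isT) /(@exp_rate_geM _ _ _ (a * u)) H.
apply: exp_rate_geW (exp_rate_ge_ge _ H).
  rewrite mulrBr mulr1; lra.
apply: filterS near_pinfty_gt0 => t t0.
have ut0 : 0 <= u * t by rewrite mulr_ge0// ltW.
apply: (@le_trans _ _ ((expR (t * (a * u)))%:E * P [set w | (u * t <= L t w)%R])%E).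
  by rewrite lee_wpmul2l ?lee_fin ?expR_ge0//; apply: inverse_stable_ge => //; exact: ltW.
have mLge : measurable [set w | u * t <= L t w].
  by rewrite -[X in measurable X]setTI; exact: measurable_fun_le.
rewrite -[X in P X]setIT -integral_indic// -ge0_integralZl_EFin ?expR_ge0//; last first.
  by apply/measurable_EFinP; exact: measurable_indic.
apply: ge0_le_integral => //.
- by apply: emeasurable_funM => //; apply/measurable_EFinP; exact: measurable_indic.
- exact/measurable_EFinP.
move=> w _; rewrite indicE; case: (boolP (w \in _)) => /= wA.
  rewrite mule1 lee_fin ler_expR mulrC -mulrA ler_pM2l//.
  by rewrite inE in wA.
by rewrite mule0 lee_fin expR_ge0.
Qed.

End inverse_stable_subordinator.

(** * Time-changed Levy processes *)

Section uniform_integrability.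
Context d (Omega : measurableType d) (R : realType) (P : probability Omega R).

(* Uniform integrability from an exponent [p > 1], through
   [expR y <= expR (min y q) + expR (p y - (p - 1) q)]. *)
Lemma le_integral_expR_lim (y_ : nat -> Omega -> R) (y : Omega -> R)
    (b_ : nat -> R) (p b C : R) :
  (forall n, measurable_fun setT (y_ n)) -> measurable_fun setT y ->
  (forall w, y_ n w @[n --> \oo] --> y w) ->
  1 < p -> (forall n, \int[P]_w (expR (p * y_ n w))%:E <= C%:E)%E ->
  (forall n, (b_ n)%:E <= \int[P]_w (expR (y_ n w))%:E)%E ->
  b_ n @[n --> \oo] --> b ->
  (b%:E <= \int[P]_w (expR (y w))%:E)%E.
Proof.
move=> my_ my cy p1 yC by_ cb.
have C0 : 0 <= C.
  rewrite -lee_fin; apply: le_trans (yC 0%N).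
  by apply: integral_ge0 => w _; rewrite lee_fin expR_ge0.
pose trunc q (z : R) := expR (Num.min z q).
have ctrunc q : continuous (trunc q).
  move=> z; apply: continuous_comp; last exact: continuous_expR.
  by apply: (@continuous_min R R id (cst q)); [exact: cvg_id|exact: cvg_cst].
have mtrunc q (z : Omega -> R) : measurable_fun setT z ->
    measurable_fun setT (fun w => (trunc q (z w))%:E).
  move=> mz; apply/measurable_EFinP; apply: measurableT_comp => //.
  exact: continuous_measurable_fun.
have trunc0 q z : (0 <= (trunc q z)%:E)%E by rewrite lee_fin expR_ge0.
have mexp (z : Omega -> R) : measurable_fun setT z ->
    measurable_fun setT (fun w => (expR (z w))%:E).
  by move=> mz; apply/measurable_EFinP; exact: measurableT_comp.
have mpy n : measurable_fun setT (fun w => (expR (p * y_ n w))%:E).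
  by apply: mexp; exact: measurable_funM.
have step q : (b%:E <= \int[P]_w (expR (y w))%:E + (expR (- (p - 1) * q) * C)%:E)%E.
  (* Truncation at level [q] bounds the integrands by [expR q], so dominated convergence applies. *)
  have cI : (\int[P]_w (trunc q (y_ n w))%:E @[n --> \oo] -->
             \int[P]_w (trunc q (y w))%:E)%E.
    apply: (@dominated_cvg _ _ _ P _ measurableT _ _ (cst (expR q)%:E)) => //.
    - by move=> n; exact: mtrunc.
    - move=> w _; apply: cvg_EFin; first exact: nearW.
      by apply: continuous_cvg; [exact: ctrunc|exact: cy].
    - exact: finite_measure_integrable_cst.
    - by move=> n w _; rewrite gee0_abs// lee_fin ler_expR ge_min lexx orbT.
  have cR : ((b_ n - expR (- (p - 1) * q) * C)%:E @[n --> \oo] -->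
      (b - expR (- (p - 1) * q) * C)%:E)%E.
    apply: cvg_EFin; first exact: nearW.
    by apply: cvgB => //; exact: cvg_cst.
  rewrite -leeBlDr// -EFinB.
  apply: (@le_trans _ _ (\int[P]_w (trunc q (y w))%:E)%E); last first.
    apply: ge0_le_integral => //; [exact: mtrunc|exact: mexp|].
    by move=> w _; rewrite lee_fin ler_expR ge_min lexx.
  rewrite -(cvg_lim _ cR)// -(cvg_lim _ cI)//.
  apply: lee_lim; [exact: cvgP cR|exact: cvgP cI|]; apply: nearW => n.
  rewrite EFinB leeBlDr//; apply: (le_trans (by_ n)).
  apply: (@le_trans _ _ (\int[P]_w ((trunc q (y_ n w))%:E +
     (expR (- (p - 1) * q))%:E * (expR (p * y_ n w))%:E))%E).
    apply: ge0_le_integral => //.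
    - exact: mexp.
    - by apply: emeasurable_funD; [exact: mtrunc|exact: emeasurable_funM].
    move=> w _; rewrite -EFinM -EFinD lee_fin -expRD /trunc.
    have [yq|qy] := leP (y_ n w) q; first by rewrite lerDl expR_ge0.
    rewrite -[leLHS]add0r lerD ?expR_ge0// ler_expR; nra.
  rewrite ge0_integralD//.
  - rewrite ge0_integralZl_EFin ?expR_ge0// EFinM leeD2l//.
    by rewrite lee_wpmul2l// lee_fin expR_ge0.
  - exact: mtrunc.
  - exact: emeasurable_funM.
apply/lee_addgt0Pr => e e0.
(* With this level the truncation error is [e * C / (C + 1) <= e]. *)
pose q := (ln ((C + 1) / e)) / (p - 1).
have p10 : 0 < p - 1 by rewrite subr_gt0.
apply: (le_trans (step q)); rewrite leeD2l// lee_fin.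
have -> : - (p - 1) * q = - ln ((C + 1) / e) by rewrite /q; field; rewrite gt_eqF.
have C10 : 0 < C + 1 by rewrite ltr_wpDl.
rewrite expRN lnK ?posrE ?divr_gt0// invf_div mulrAC ler_pdivrMr//.
by rewrite ler_pM2l// lerDl.
Qed.

End uniform_integrability.

Section random_time.
Context d (Omega : measurableType d) (R : realType) (P : probability Omega R).

Lemma measurable_upper_grid n : measurable_fun setT (@upper_grid R n).
Proof.
apply: nondecreasing_measurable => // x y xy.
rewrite ler_wpM2r ?invr_ge0// ler_nat ltnS; apply: le_truncn.
by rewrite ler_wpM2r.
Qed.

(** With [T] rounded to the grid, the composite is [X] at a fixed time on each of countably many
    measurable pieces; right continuity then passes measurability to the limit. *)
Lemma measurable_levy_random_time (X : R -> {RV P >-> R}) (T : Omega -> R) :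
  is_levy_process X -> measurable_fun setT T -> (forall w, 0 <= T w) ->
  measurable_fun setT (fun w => X (T w) w).
Proof.
move=> levyX mT T0.
apply: (@measurable_fun_cvg _ _ _ _ (fun n w => X (upper_grid n (T w)) w)).
- move=> n.
  pose F m := [set w | Num.truncn (T w * n.+1%:R) = m].
  have mF m : measurable (F m).
    have -> : F m = (upper_grid n \o T) @^-1` [set m.+1%:R / n.+1%:R].
      apply/seteqP; split=> w /=; first by rewrite /upper_grid => ->.
      rewrite /upper_grid => /(congr1 ( *%R^~ n.+1%:R)); rewrite /= !divfK//.
      by move/eqP; rewrite eqr_nat => /eqP[].
    rewrite -[X in measurable X]setTI.
    by apply: (measurableT_comp (@measurable_upper_grid n) mT).
  have -> : [set: Omega] = \bigcup_m F m.
    by apply/seteqP; split=> w // _; exists (Num.truncn (T w * n.+1%:R)).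
  apply/measurable_fun_bigcup => // m.
  apply: (eq_measurable_fun (X (m.+1%:R / n.+1%:R))).
    by move=> w; rewrite inE /F/= /upper_grid => ->.
  exact: measurable_funTS.
- move=> w _; have /cvg_at_rightP := @levy_right_continuous _ _ _ _ _ levyX w _ (T0 w).
  by apply; split; [move=> n; exact: upper_grid_gt|exact: cvg_upper_grid].
Qed.

Lemma sigma_of_process_measurable (X : R -> {RV P >-> R}) A :
  sigma_of_process X A -> measurable A.
Proof.
apply: smallest_sub; first exact: sigma_algebra_measurable.
move=> B [t t0 [C mC <-]]; rewrite setTI.
by rewrite -[X in measurable X]setTI; exact: measurable_funP.
Qed.

Lemma sigma_of_process_rv (X : R -> {RV P >-> R}) (f : R -> R) (t : R) B :
  0 <= t -> measurable_fun setT f -> measurable B ->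
  sigma_of_process X ((fun w => f (X t w)) @^-1` B).
Proof.
move=> t0 mf mB; apply: sub_sigma_algebra; exists t => //.
exists (f @^-1` B); last by rewrite setTI.
by rewrite -[X in measurable X]setTI; exact: mf.
Qed.

End random_time.

Lemma eq_integral_cover d (T : measurableType d) (R : realType)
    (mu : {measure set T -> \bar R}) (D : (set T)^nat) (f g : T -> \bar R) :
  (forall n, measurable (D n)) -> trivIset setT D -> \bigcup_n D n = setT ->
  measurable_fun setT f -> measurable_fun setT g ->
  (forall x, 0 <= f x)%E -> (forall x, 0 <= g x)%E ->
  (forall n, \int[mu]_(x in D n) f x = \int[mu]_(x in D n) g x)%E ->
  (\int[mu]_x f x = \int[mu]_x g x)%E.
Proof.
move=> mD tD DT mf mg f0 g0 fg.
have E (u : T -> \bar R) : measurable_fun setT u -> (forall x, 0 <= u x)%E ->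
    (\int[mu]_x u x = \sum_(n <oo) \int[mu]_(x in D n) u x)%E.
  by move=> mu0 u0; rewrite -ge0_integral_bigcup// DT.
by rewrite E// E//; apply: eq_eseriesr => n _; exact: fg.
Qed.

(** * Conditioning on the clocks *)

Section time_change.
Context d (Omega : measurableType d) (R : realType) (P : probability Omega R).
Context (h k : nat) (c : 'I_h -> 'I_k -> R).
Context (S : 'I_h -> R -> {RV P >-> R}) (L : 'I_k -> R -> {RV P >-> R}).
Hypothesis c_gt0 : forall i j, 0 < c i j.
Hypothesis S_levy : forall i, is_levy_process (S i).
Hypothesis indep : independent_processes (all_processes S L).
Variable t : R.
Hypothesis t_ge0 : 0 <= t.
Hypothesis L_ge0 : forall j w, 0 <= L j t w.

Definition grid_inverse n j w := upper_grid n (L j t w).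
Local Notation U := grid_inverse.
Definition clock (v : 'I_k -> R) i : R := \sum_(j < k) c i j * v j.
Local Notation tau := clock.

Let measurable_U n j : measurable_fun setT (U n j).
Proof. exact: (measurableT_comp (@measurable_upper_grid R n)). Qed.

Let U_ge0 n j w : 0 <= U n j w.
Proof. by rewrite ltW// (le_lt_trans (L_ge0 j w))// upper_grid_gt. Qed.

Lemma clock_ge0 v i : (forall j, 0 <= v j) -> 0 <= tau v i.
Proof. by move=> v0; apply: sumr_ge0 => j _; rewrite mulr_ge0// ltW. Qed.

Variable theta : 'I_h -> R.
Hypothesis kappa_fin : forall i, kappa (S i) (theta i) \is a fin_num.
Local Notation kap i := (fine (kappa (S i) (theta i))).
Definition drift j := \sum_(i < h) c i j * kap i.
Local Notation a := drift.

Let F := fun p => sigma_of_process (all_processes S L p).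
Let mF p A : F p A -> measurable A.
Proof. exact: sigma_of_process_measurable. Qed.

(** On this event the clocks are the constants [tau v i], so each side is the integral of a finite
    product with one factor per independent process. The factors from [L] are the same indicators on
    both sides, and the factor from [S i] integrates to [expR (kap i * tau v i)]. *)
Lemma integral_time_change_level n (v : 'I_k -> R) : (forall j, 0 <= v j) ->
  (\int[P]_(w in [set w | forall j, U n j w = v j])
     (expR (\sum_(i < h) theta i * S i (tau (U n ^~ w) i) w))%:E =
   \int[P]_(w in [set w | forall j, U n j w = v j])
     (expR (\sum_(i < h) kap i * tau (U n ^~ w) i))%:E)%E.
Proof.
move=> v0; set E := [set w | _].
pose ind j w : R := \1_[set x | x = v j] (U n j w).
pose f (p : 'I_h + 'I_k) w := match p with
  | inl i => expR (theta i * S i (tau v i) w) | inr j => ind j w end.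
pose g (p : 'I_h + 'I_k) w := match p with
  | inl i => expR (kap i * tau v i) | inr j => ind j w end.
have indE w : \prod_(j < k) ind j w = \1_E w.
  have [Ew|Ew] := pselect (E w).
    rewrite [RHS]indicE mem_set// big1// => j _.
    by rewrite /ind indicE mem_set//=; exact: Ew.
  rewrite [RHS]indicE memNset//.
  have [j jE] : exists j, U n j w <> v j.
    by apply: contrapT => /forallNP H; apply: Ew => j; exact: contrapT (H j).
  by rewrite (bigD1 j)//= /ind indicE memNset// mul0r.
have -> : (\int[P]_(w in E) (expR (\sum_(i < h) theta i * S i (tau (U n ^~ w) i) w))%:E =
    \int[P]_w (\prod_p f p w)%:E)%E.
  rewrite [LHS]integral_mkcond; apply: eq_integral => w _.
  rewrite epatch_indic/= -EFinM; congr EFin.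
  rewrite big_sumType/= indE; have [Ew|Ew] := pselect (E w); last first.
    by rewrite indicE memNset// !mulr0.
  congr (_ * _); rewrite expR_sum; apply: eq_bigr => i _.
  by have -> : U n ^~ w = v by apply/funext.
have -> : (\int[P]_(w in E) (expR (\sum_(i < h) kap i * tau (U n ^~ w) i))%:E =
    \int[P]_w (\prod_p g p w)%:E)%E.
  rewrite [LHS]integral_mkcond; apply: eq_integral => w _.
  rewrite epatch_indic/= -EFinM; congr EFin.
  rewrite big_sumType/= indE; have [Ew|Ew] := pselect (E w); last first.
    by rewrite indicE memNset// !mulr0.
  congr (_ * _); rewrite expR_sum; apply: eq_bigr => i _.
  by have -> : U n ^~ w = v by apply/funext.
have ind_ge0 j w : 0 <= ind j w by rewrite /ind.
have F_ind j B : measurable B -> F (inr j) (ind j @^-1` B).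
  move=> mB; apply: (@sigma_of_process_rv _ _ _ _ (L j)
    (fun x => \1_[set x | x = v j] (upper_grid n x)) t) => //.
  apply: (measurableT_comp _ (@measurable_upper_grid R n)).
  by apply: measurable_indic; exact: measurable_set1.
have mexp (q : R) : measurable_fun setT (fun x : R => expR (q * x)).
  by apply: measurableT_comp => //; exact: mulrl_measurable.
rewrite !(integral_prod_indep indep mF).
- rewrite !big_sumType/=; congr (_ * _)%E; apply: eq_bigr => i _.
  rewrite levy_mgf//; last exact: clock_ge0.
  by rewrite integral_cst// [X in (_ * X)%E]probability_setT mule1 mulrC.
- by case=> [i|j] w //=; exact: expR_ge0.
- case=> [i|j] B mB /=; last exact: F_ind.
  apply: (@sigma_of_process_rv _ _ _ _ (S i) (fun=> expR (kap i * tau v i)) 0) => //.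
- by case=> [i|j] w //=; exact: expR_ge0.
- case=> [i|j] B mB /=; last exact: F_ind.
  apply: (@sigma_of_process_rv _ _ _ _ (S i) (fun x => expR (theta i * x)) (tau v i)) => //.
  exact: clock_ge0.
Qed.

Let S_tau_measurable i (T : 'I_k -> Omega -> R) :
  (forall j, measurable_fun setT (T j)) -> (forall j w, 0 <= T j w) ->
  measurable_fun setT (fun w => S i (tau (T ^~ w) i) w).
Proof.
move=> mT T0; apply: measurable_levy_random_time => //.
  by apply: measurable_sum => j; exact: measurable_funM.
by move=> w; exact: clock_ge0.
Qed.

Definition exponent (T : 'I_k -> Omega -> R) w := \sum_(i < h) theta i * S i (tau (T ^~ w) i) w.

Let measurable_exponent (T : 'I_k -> Omega -> R) :
  (forall j, measurable_fun setT (T j)) -> (forall j w, 0 <= T j w) ->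
  measurable_fun setT (exponent T).
Proof.
move=> mT T0; apply: measurable_sum => i; apply: measurable_funM => //.
exact: S_tau_measurable.
Qed.

(** Summing over the countably many levels replaces each [S i] by its cumulant; exchanging the sums
    over [i] and [j] regroups the exponent by inverse subordinator, and independence is used a
    second time. *)
Lemma integral_time_change_grid n :
  (\int[P]_w (expR (exponent (U n) w))%:E =
   \prod_(j < k) \int[P]_w (expR (a j * U n j w))%:E)%E.
Proof.
pose idx w := [ffun j : 'I_k => Num.truncn (L j t w * n.+1%:R)].
pose val (m : {ffun 'I_k -> nat}) j : R := (m j).+1%:R / n.+1%:R.
have idxE m : [set w | idx w = m] = [set w | forall j, U n j w = val m j].
  apply/seteqP; split=> w /=.
    by move=> <- j; rewrite /val ffunE.
  move=> H; apply/ffunP => j; rewrite ffunE.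
  have := H j; rewrite /grid_inverse /upper_grid /val => /(congr1 ( *%R^~ n.+1%:R)).
  by rewrite /= !divfK// => /eqP; rewrite eqr_nat => /eqP[].
(* Vectors of grid indices are numbered by [pickle] to obtain a sequence of disjoint pieces; a code
   that is not attained gives an empty piece. *)
pose D q := [set w | pickle (idx w) = q].
have DE q : D q = set0 \/ exists m, D q = [set w | forall j, U n j w = val m j].
  have [->|/set0P[w0 /= Dw0]] := eqVneq (D q) set0; [by left|right].
  exists (idx w0); rewrite -idxE; apply/seteqP; split=> w /=.
    by rewrite /D/= => Dw; apply: (pcan_inj (@pickleK _)); rewrite Dw Dw0.
  by rewrite /D/= => ->.
have mlevel m : measurable [set w | forall j, U n j w = val m j].
  have -> : [set w | forall j, U n j w = val m j] =
      \bigcap_(j in [set: 'I_k]) [set w | U n j w = val m j].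
    by apply/seteqP; split=> w H j; [move=> _; exact: H|exact: H].
  apply: fin_bigcap_measurable => // j _.
  rewrite -[X in measurable X]setTI.
  exact: (measurable_U n j measurableT (measurable_set1 (val m j))).
have mD q : measurable (D q).
  by have [->|[m ->]] := DE q; [exact: measurable0|exact: mlevel].
have DT : [set: Omega] = \bigcup_q D q.
  by apply/seteqP; split=> w // _; exists (pickle (idx w)).
have tD : trivIset setT D.
  by move=> q q' _ _ [w [/= <- <-]].
transitivity (\int[P]_w (expR (\sum_(i < h) kap i * tau (U n ^~ w) i))%:E)%E.
  apply: (eq_integral_cover mD tD (esym DT)).
  - by apply/measurable_EFinP; apply: measurableT_comp => //; exact: measurable_exponent.
  - apply/measurable_EFinP; apply: measurableT_comp => //.
    apply: measurable_sum => i; apply: measurable_funM => //.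
    by apply: measurable_sum => j; exact: measurable_funM.
  - by move=> w; rewrite lee_fin expR_ge0.
  - by move=> w; rewrite lee_fin expR_ge0.
  - move=> q; have [->|[m ->]] := DE q; first by rewrite !integral_set0.
    by apply: integral_time_change_level => j; exact: divr_ge0.
(* The factors 1 extend the product to all [h + k] processes, the family whose independence is
   assumed. *)
transitivity (\int[P]_w (\prod_(p : 'I_h + 'I_k)
    match p with inl _ => 1 | inr j => expR (a j * U n j w) end)%:E)%E.
  apply: eq_integral => w _; rewrite big_sumType/= big1_eq mul1r -expR_sum.
  congr (expR _)%:E; under eq_bigr do rewrite /clock mulr_sumr.
  rewrite exchange_big/=; apply: eq_bigr => j _; rewrite /drift mulr_suml.
  by apply: eq_bigr => i _; rewrite mulrCA mulrA.
rewrite (integral_prod_indep indep mF (f := fun p w =>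
    match p with inl _ => 1 | inr j => expR (a j * U n j w) end)).
- rewrite big_sumType/= big1 ?mul1e// => i _.
  by rewrite integral_cst// [X in (_ * X)%E]probability_setT mule1.
- by case=> [i|j] w //; exact: expR_ge0.
- case=> [i|j] B mB.
    exact: (@sigma_of_process_rv _ _ _ _ (S i) (fun=> 1) 0).
  apply: (@sigma_of_process_rv _ _ _ _ (L j) (fun x => expR (a j * upper_grid n x)) t) => //.
  apply: measurableT_comp => //; apply: measurable_funM => //.
  exact: measurable_upper_grid.
Qed.


(** Rounding moves [L j t] by at most [n.+1%:R^-1]. The absolute value is needed because [a j] may
    have either sign. *)
Lemma integral_time_change_grid_le n :
  (\int[P]_w (expR (exponent (U n) w))%:E <=
   (expR (n.+1%:R^-1 * \sum_(j < k) `|a j|))%:E *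
     \prod_(j < k) \int[P]_w (expR (a j * L j t w))%:E)%E.
Proof.
rewrite integral_time_change_grid mulr_sumr expR_sum -prodEFin -big_split/=.
have mL j : measurable_fun setT (fun w => (expR (a j * L j t w))%:E).
  by apply/measurable_EFinP; apply: measurableT_comp => //; exact: measurable_funM.
suff H j : (0 <= \int[P]_w (expR (a j * U n j w))%:E <=
    (expR (n.+1%:R^-1 * `|a j|))%:E * \int[P]_w (expR (a j * L j t w))%:E)%E.
  suff : (0 <= \prod_(j < k) \int[P]_w (expR (a j * U n j w))%:E <=
    \prod_(j < k) ((expR (n.+1%:R^-1 * `|a j|))%:E *
                   \int[P]_w (expR (a j * L j t w))%:E))%E by case/andP.
  elim/big_ind2 : _ => [|x x' y y' /andP[x0 xx'] /andP[y0 yy']|//].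
    by rewrite lee01 lexx.
  by rewrite mule_ge0//= lee_pmul.
apply/andP; split; first by apply: integral_ge0 => w _; rewrite lee_fin expR_ge0.
rewrite -ge0_integralZl_EFin ?expR_ge0//.
apply: ge0_le_integral => //.
- by apply/measurable_EFinP; apply: measurableT_comp => //; exact: measurable_funM.
- exact: emeasurable_funM.
move=> w _; rewrite -EFinM -expRD lee_fin ler_expR -lerBlDr -mulrBr.
apply: (le_trans (ler_norm _)); rewrite normrM mulrC ler_wpM2r//.
rewrite ger0_norm ?subr_ge0; last exact/ltW/upper_grid_gt.
by rewrite lerBlDl upper_grid_le.
Qed.

Lemma integral_time_change_grid_ge n :
  ((expR (- n.+1%:R^-1 * \sum_(j < k) `|a j|))%:E *
     \prod_(j < k) \int[P]_w (expR (a j * L j t w))%:E <=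
   \int[P]_w (expR (exponent (U n) w))%:E)%E.
Proof.
rewrite integral_time_change_grid mulr_sumr expR_sum -prodEFin -big_split/=.
have mL j : measurable_fun setT (fun w => (expR (a j * L j t w))%:E).
  by apply/measurable_EFinP; apply: measurableT_comp => //; exact: measurable_funM.
suff H j : (0 <= (expR (- n.+1%:R^-1 * `|a j|))%:E *
      \int[P]_w (expR (a j * L j t w))%:E <= \int[P]_w (expR (a j * U n j w))%:E)%E.
  suff : (0 <= \prod_(j < k) ((expR (- n.+1%:R^-1 * `|a j|))%:E *
                   \int[P]_w (expR (a j * L j t w))%:E) <=
     \prod_(j < k) \int[P]_w (expR (a j * U n j w))%:E)%E by case/andP.
  elim/big_ind2 : _ => [|x x' y y' /andP[x0 xx'] /andP[y0 yy']|//].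
    by rewrite lee01 lexx.
  by rewrite mule_ge0//= lee_pmul.
rewrite mule_ge0 ?lee_fin ?expR_ge0//=; last first.
  by apply: integral_ge0 => w _; rewrite lee_fin expR_ge0.
rewrite -ge0_integralZl_EFin ?expR_ge0//.
apply: ge0_le_integral => //.
- exact: emeasurable_funM.
- by apply/measurable_EFinP; apply: measurableT_comp => //; exact: measurable_funM.
move=> w _; rewrite -EFinM -expRD lee_fin ler_expR mulNr addrC lerBlDr -lerBlDl -mulrBr.
apply: (le_trans (ler_norm _)); rewrite normrM mulrC ler_wpM2r//.
rewrite distrC ger0_norm ?subr_ge0; last exact/ltW/upper_grid_gt.
by rewrite lerBlDl upper_grid_le.
Qed.

Let cvg_expR0 (s : nat -> R) (A : R) : s n @[n --> \oo] --> 0 ->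
  expR (s n * A) @[n --> \oo] --> (1 : R).
Proof.
move=> s0; rewrite -expR0 -(mul0r A); apply: continuous_cvg.
  exact: continuous_expR.
exact: cvgMl.
Qed.

Hypothesis k_gt0 : (0 < k)%N.

Let cvg_exponent w : exponent (U n) w @[n --> \oo] --> exponent (fun j => L j t) w.
Proof.
apply: cvg_big => [|i _]; first exact: add_continuous.
apply: cvgMr.
have L0 : 0 <= clock (fun j => L j t w) i by exact: clock_ge0.
have /cvg_at_rightP := @levy_right_continuous _ _ _ _ _ (S_levy i) w _ L0.
apply; split => [n|].
  (* Right continuity requires times strictly above the clock; strictness of the summands passes to
     the sum because there is at least one, [k] being positive. *)
  apply: ltr_sum; last by move=> j _; rewrite ltr_pM2l// upper_grid_gt.
  by apply/hasP; exists (Ordinal k_gt0); rewrite ?mem_index_enum.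
apply: cvg_big => [|j _]; first exact: add_continuous.
by apply: cvgMr; exact: cvg_upper_grid.
Qed.

Variable m : 'I_k -> R.
Hypothesis mE : forall j, (\int[P]_w (expR (a j * L j t w))%:E = (m j)%:E)%E.

Let prodE : (\prod_(j < k) \int[P]_w (expR (a j * L j t w))%:E = (\prod_(j < k) m j)%:E)%E.
Proof. by rewrite -prodEFin; apply: eq_bigr => j _; exact: mE. Qed.

Let cvg_bound (s : nat -> R) (A : R) : s n @[n --> \oo] --> 0 ->
  expR (s n * A) * \prod_(j < k) m j @[n --> \oo] --> \prod_(j < k) m j.
Proof.
move=> s0; rewrite -[X in _ --> X]mul1r; apply: cvgMl; exact: cvg_expR0.
Qed.

Lemma integral_time_change_le :
  (\int[P]_w (expR (exponent (fun j => L j t) w))%:E <= (\prod_(j < k) m j)%:E)%E.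
Proof.
apply: (fatou_cvg (f_ := fun n w => expR (exponent (U n) w))
  (l_ := fun n => (expR (n.+1%:R^-1 * \sum_(j < k) `|a j|) * \prod_(j < k) m j)%:E)).
- by move=> n; apply: measurableT_comp => //; exact: measurable_exponent.
- by move=> n w; exact: expR_ge0.
- by move=> w; apply: continuous_cvg; [exact: continuous_expR|exact: cvg_exponent].
- by move=> n; rewrite EFinM -prodE; exact: integral_time_change_grid_le.
- apply: cvg_EFin; first exact: nearW.
  by apply: cvg_bound; exact: cvg_harmonic.
Qed.

Lemma integral_time_change_ge (p C : R) : 1 < p ->
  (forall n, \int[P]_w (expR (p * exponent (U n) w))%:E <= C%:E)%E ->
  ((\prod_(j < k) m j)%:E <= \int[P]_w (expR (exponent (fun j => L j t) w))%:E)%E.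
Proof.
move=> p1 pC.
apply: (le_integral_expR_lim (y_ := fun n => exponent (U n)) (p := p) (C := C)
  (b_ := fun n => expR (- n.+1%:R^-1 * \sum_(j < k) `|a j|) * \prod_(j < k) m j)) => //.
- by move=> n; exact: measurable_exponent.
- exact: measurable_exponent.
- by move=> n; rewrite EFinM -prodE; exact: integral_time_change_grid_ge.
- apply: cvg_bound; rewrite -oppr0; apply: cvgN; exact: cvg_harmonic.
Qed.

(** Used at [p *: theta] to supply the bound, uniform in the grid, that [integral_time_change_ge]
    requires at [theta]. *)
Lemma integral_grid_bounded : exists C, forall n,
  (\int[P]_w (expR (exponent (U n) w))%:E <= C%:E)%E.
Proof.
exists (expR (\sum_(j < k) `|a j|) * \prod_(j < k) m j) => n.
apply: (le_trans (integral_time_change_grid_le n)).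
rewrite EFinM prodE lee_wpmul2r//.
  rewrite lee_fin prodr_ge0// => j _; rewrite -lee_fin -mE.
  by apply: integral_ge0 => w _; rewrite lee_fin expR_ge0.
rewrite lee_fin ler_expR ler_piMl ?sumr_ge0//.
by rewrite invf_le1// ler1n.
Qed.

End time_change.

Section rate_of_product.
Context {R : realType} (I : Type) (s : seq I) (f : I -> R -> \bar R) (a : I -> R).
Hypothesis f0 : forall i t, (0 <= f i t)%E.

Lemma exp_rate_le_prod : (forall i, exp_rate_le (f i) (a i)) ->
  exp_rate_le (fun t => \prod_(i <- s) f i t)%E (\sum_(i <- s) a i).
Proof.
move=> fa; elim: s => [|i s' IH].
  rewrite big_nil; under eq_fun do rewrite big_nil.
  exact: exp_rate_le_cst.
rewrite big_cons; under eq_fun do rewrite big_cons.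
move=> e e0; have e20 : 0 < e / 2 by rewrite divr_gt0.
apply: filterS2 (fa i _ e20) (IH _ e20) => t h1 h2.
have -> : t * (a i + \sum_(j <- s') a j + e) =
  t * (a i + e / 2) + t * (\sum_(j <- s') a j + e / 2) by field.
by rewrite expRD EFinM lee_pmul// prode_ge0.
Qed.

Lemma exp_rate_ge_prod : (forall i, exp_rate_ge (f i) (a i)) ->
  exp_rate_ge (fun t => \prod_(i <- s) f i t)%E (\sum_(i <- s) a i).
Proof.
move=> fa; elim: s => [|i s' IH].
  rewrite big_nil; under eq_fun do rewrite big_nil.
  move=> e e0; apply: filterS near_pinfty_gt0 => t t0.
  by rewrite lee_fin -expR0 ler_expR sub0r mulrN oppr_le0 mulr_ge0// ltW.
rewrite big_cons; under eq_fun do rewrite big_cons.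
move=> e e0; have e20 : 0 < e / 2 by rewrite divr_gt0.
apply: filterS2 (fa i _ e20) (IH _ e20) => t h1 h2.
have -> : t * (a i + \sum_(j <- s') a j - e) =
  t * (a i - e / 2) + t * (\sum_(j <- s') a j - e / 2) by field.
by rewrite expRD EFinM lee_pmul// lee_fin expR_ge0.
Qed.

End rate_of_product.

Section model_rates.
Context d (Omega : measurableType d) (R : realType) (P : probability Omega R).
Context (h k : nat) (c : 'I_h -> 'I_k -> R) (nu : R).
Context (S : 'I_h -> R -> {RV P >-> R}) (L : 'I_k -> R -> {RV P >-> R}).
Hypotheses (k_gt0 : (0 < k)%N) (c_gt0 : forall i j, 0 < c i j).
Hypotheses (nu_gt0 : 0 < nu) (nu_lt1 : nu < 1).
Hypothesis S_levy : forall i, is_levy_process (S i).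
Hypothesis L_inverse : forall j, is_inverse_stable_subordinator nu (L j).
Hypothesis indep : independent_processes (all_processes S L).

Local Notation Z := (scaled_time_changed c S L).

Lemma mgf_scaled_time_changed (theta : 'rV[R]_h) (t : R) : 0 < t ->
  (mgf P Z theta t =
   \int[P]_w (expR (exponent c S (theta 0) (fun j => L j t) w))%:E)%E.
Proof.
move=> t0; apply: eq_integral => w _; congr (expR _)%:E.
rewrite /dot mulr_sumr; apply: eq_bigr => i _; rewrite mxE /clock.
by set x := S i _ w; field; rewrite gt_eqF.
Qed.

Let L_ge0 j t w : 0 <= t -> 0 <= L j t w.
Proof. by move=> t0; have [X [_ LX]] := L_inverse j; exact: inverse_stable_ge0 LX _ _ t0. Qed.

Lemma measurable_scaled_time_changed (t : R) (i : 'I_h) : 0 < t ->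
  measurable_fun setT (fun w => Z t w 0 i).
Proof.
move=> t0; under eq_fun do rewrite mxE; apply: measurable_funM => //.
apply: measurable_levy_random_time => //.
  by apply: measurable_sum => j; exact: measurable_funM.
by move=> w; apply: sumr_ge0 => j _; rewrite mulr_ge0 ?L_ge0// ltW.
Qed.

Definition finite_kappa (theta : 'rV[R]_h) :=
  forall i, kappa (S i) (theta 0 i) \is a fin_num.

Definition Upsilon_fin (theta : 'rV[R]_h) : R :=
  \sum_(j < k) inverse_stable_rate nu (drift c S (theta 0) j).

Let mgf_L j a t : 0 <= t -> exists m, (\int[P]_w (expR (a * L j t w))%:E = m%:E)%E.
Proof.
move=> t0; have [X [stX LX]] := L_inverse j.
exact: (mgf_inverse_stable_fin nu_gt0 stX LX).
Qed.

Let mgf_L_fun a t : 0 <= t ->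
  exists m, forall j, (\int[P]_w (expR (a j * L j t w))%:E = (m j)%:E)%E.
Proof.
move=> t0; exists (fun j => fine (\int[P]_w (expR (a j * L j t w))%:E)%E) => j.
by have [m ->] := mgf_L j (a j) t0.
Qed.

Lemma mgf_scaled_time_changed_rate_le (theta : 'rV[R]_h) : finite_kappa theta ->
  exp_rate_le (mgf P Z theta) (Upsilon_fin theta).
Proof.
move=> fk.
apply: (@exp_rate_le_le _ _ (fun t => \prod_(j < k)
   \int[P]_w (expR (drift c S (theta 0) j * L j t w))%:E)%E).
  apply: filterS near_pinfty_gt0 => t t0; rewrite mgf_scaled_time_changed//.
  have [m mE] := mgf_L_fun (drift c S (theta 0)) (ltW t0).
  rewrite (eq_bigr _ (fun j _ => mE j)) prodEFin.
  apply: integral_time_change_le => //; first exact: ltW.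
  by move=> j w; exact/L_ge0/ltW.
apply: exp_rate_le_prod => j.
  by move=> t; apply: integral_ge0 => w _; rewrite lee_fin expR_ge0.
have [X [stX LX]] := L_inverse j; exact: (mgf_inverse_stable_rate_le nu_gt0 stX LX).
Qed.

Lemma mgf_scaled_time_changed_rate_ge (theta : 'rV[R]_h) (p : R) : 1 < p ->
  finite_kappa theta -> finite_kappa (p *: theta) ->
  exp_rate_ge (mgf P Z theta) (Upsilon_fin theta).
Proof.
move=> p1 fk fpk.
apply: (@exp_rate_ge_ge _ (fun t => \prod_(j < k)
   \int[P]_w (expR (drift c S (theta 0) j * L j t w))%:E)%E).
  apply: filterS near_pinfty_gt0 => t t0; rewrite mgf_scaled_time_changed//.
  have [m mE] := mgf_L_fun (drift c S (theta 0)) (ltW t0).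
  have [mp mpE] := mgf_L_fun (drift c S ((p *: theta) 0)) (ltW t0).
  rewrite (eq_bigr _ (fun j _ => mE j)) prodEFin.
  have Lt0 j w : 0 <= L j t w by exact/L_ge0/ltW.
  have [C HC] := integral_grid_bounded c_gt0 S_levy indep (ltW t0) Lt0 fpk mpE.
  apply: (integral_time_change_ge c_gt0 S_levy indep (ltW t0) Lt0 fk k_gt0 mE p1 (C := C)).
  move=> n; apply: le_trans (HC n); rewrite le_eqVlt; apply/orP; left; apply/eqP.
  apply: eq_integral => w _; congr (expR _)%:E; rewrite /exponent mulr_sumr.
  by apply: eq_bigr => i _; rewrite mxE mulrA.
apply: exp_rate_ge_prod => j.
have [X [stX LX]] := L_inverse j; exact: (mgf_inverse_stable_rate_ge nu_gt0 nu_lt1 stX LX).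
Qed.

End model_rates.

(** * The Gartner-Ellis theorem *)

Section compact_seq_cover.
Import finmap.

Lemma compact_seq_cover (T : ptopologicalType) (I : choiceType) (K : set T)
    (D : set I) (f : I -> set T) :
  compact K -> (forall i, D i -> open (f i)) ->
  (forall x, K x -> exists2 i, D i & f i x) ->
  exists2 s : seq I, {in s, forall i, D i} &
    forall x, K x -> exists2 i, i \in s & f i x.
Proof.
rewrite compact_cover => cK fo Kf.
have [|E ED cov] := cK I D f fo.
  by move=> x /Kf[i Di fix_]; exists i.
exists (enum_fset E); first by move=> i iE; apply/set_mem/ED.
by move=> x /cov[i /= iE fix_]; exists i.
Qed.

End compact_seq_cover.

(** Without a minimiser, the open sets where [f] exceeds [f y], for [y] in [K], cover [K]. Among the
    finitely many [y] of a subcover, one with least value is not covered. *)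
Lemma lsc_min_compact (T : ptopologicalType) (R : realType) (f : T -> \bar R)
    (K : set T) : lower_semicontinuous f -> compact K -> K !=set0 ->
  (forall x, -oo < f x)%E -> exists2 p, K p & forall y, K y -> (f p <= f y)%E.
Proof.
move=> lscf cK [x0 Kx0] fNy.
apply: contrapT => H.
have Hlt p : K p -> exists2 y, K y & (f y < f p)%E.
  move=> Kp; apply: contrapT => Hy; apply: H; exists p => // y Ky.
  by rewrite leNgt; apply/negP => yp; apply: Hy; exists y.
have fo y : K y -> open [set z | f y < f z]%E.
  move=> Ky; case: (f y) (fNy y) => [r _| _|//].
    by move/lower_semicontinuousP : lscf; exact.
  rewrite (_ : [set z | _] = set0); first exact: open0.
  by apply/seteqP; split=> z //=; rewrite ltNge leey.
have [s DK cov] := compact_seq_cover cK fo Hlt.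
have minseq (s' : seq T) : s' != [::] ->
    exists2 y, y \in s' & forall z, z \in s' -> (f y <= f z)%E.
  elim: s' => [//|x [|x' s'] IH] _.
    by exists x; rewrite ?mem_head// => z; rewrite inE => /eqP ->.
  have [//|y ys yz] := IH.
  have [xy|yx] := leP (f x) (f y).
    exists x; rewrite ?mem_head// => z; rewrite inE => /orP[/eqP -> //|/yz].
    exact: le_trans.
  exists y; first by rewrite inE ys orbT.
  by move=> z; rewrite inE => /orP[/eqP ->|/yz//]; exact: ltW.
have [y0 y0s _] := cov _ Kx0.
have [|y ys yz] := minseq s; first by apply: contraTneq y0s => ->.
have [z zs zy] := cov _ (DK _ ys).
by have := yz _ zs; rewrite leNgt zy.
Qed.

Lemma lscD_continuous (T : topologicalType) (R : realType) (f : T -> \bar R)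
    (g : T -> R) : lower_semicontinuous f -> continuous g ->
  lower_semicontinuous (fun x => f x + (g x)%:E)%E.
Proof.
move=> lscf cg x a agf.
have [b bf bg] : exists2 b : R, (b%:E < f x)%E & a - b < g x.
  move: agf; case: (f x) => [r| |//].
    rewrite -EFinD lte_fin => arg; exists ((a - g x + r) / 2); last lra.
    rewrite lte_fin; lra.
  by move=> _; exists (a - g x + 1); rewrite ?ltry//; lra.
have [V xV Vf] := lscf x b bf.
exists (V `&` [set y | a - b < g y]).
  by apply: filterI => //; exact: (cg x) (lt_nbhsr bg).
move=> y [/Vf by_ gy]; rewrite -(subrK b a) addrC EFinD; apply: lteD => //.
Qed.

(** A parabola of slope [m] touches [f] from below at [x]. The difference quotients for [s] and
    [- s] then bound the derivative from the two sides, with an error [K * s] made smaller than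
    [e / 2]. *)
Lemma derive_at_touching (R : realType) (V : normedModType R) (f : V -> R)
    (x v : V) (m K : R) : derivable f x v -> 0 <= K ->
  (\forall s \near (0 : R), f x + s * m - K * s ^+ 2 <= f (x + s *: v)) ->
  'D_v f x = m.
Proof.
move=> df K0 H.
have Hq : q^-1 *: ((f \o shift x) (q *: v) - f x) @[q --> (0 : R)^'] --> 'D_v f x by [].
apply/eqP; rewrite -subr_eq0 -normr_le0; apply/ler_addgt0Pr => e e0; rewrite add0r.
have e20 : 0 < e / 2 by rewrite divr_gt0.
move/cvgrPdist_le : Hq => /(_ _ e20)[r1 /= r10 Hr1].
have [r2 /= r20 Hr2] := H.
pose s := Num.min (Num.min (r1 / 2) (r2 / 2)) (e / (2 * (K + 1))).
have K10 : 0 < K + 1 by rewrite ltr_wpDl.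
have s0 : 0 < s by rewrite !lt_min !divr_gt0// mulr_gt0.
have sr1 : s < r1 by rewrite !gt_min ltr_pdivrMr// ltr_pMr// ltr1n.
have sr2 : s < r2 by rewrite !gt_min [r2 / 2 < _]ltr_pdivrMr// ltr_pMr// ltr1n orbT.
have Ks : K * s <= e / 2.
  have : s <= e / (2 * (K + 1)) by rewrite !ge_min lexx !orbT.
  rewrite ler_pdivlMr ?mulr_gt0// => h; nra.
have key (b : bool) : f x + (-1) ^+ b * s * m - K * s ^+ 2 <= f (x + ((-1) ^+ b * s) *: v) /\
   `|'D_v f x - ((-1) ^+ b * s)^-1 * (f (x + ((-1) ^+ b * s) *: v) - f x)| <= e / 2.
  have nb : `|0 - (-1) ^+ b * s| = s.
    by rewrite sub0r normrN normrM normr_sign mul1r gtr0_norm.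
  split.
    have := Hr2 ((-1) ^+ b * s); rewrite /= nb => /(_ sr2).
    by rewrite exprMn sqrr_sign mul1r.
  have := Hr1 ((-1) ^+ b * s); rewrite /= nb => /(_ sr1); rewrite [_ *: v + x]addrC.
  by apply; rewrite mulf_neq0 ?signr_eq0// gt_eqF.
have [p1 p2] := key false; have [n1 n2] := key true.
move: p1 p2 n1 n2; rewrite !expr0 !expr1 !mul1r !mulN1r invrN.
set fp := f (x + s *: v); set fn := f (x + (- s) *: v).
rewrite !ler_norml => p1 /andP[p2 p3] n1 /andP[n2 n3].
have p4 : m - K * s <= s^-1 * (fp - f x).
  rewrite ler_pdivlMl//; nra.
have n4 : - s^-1 * (fn - f x) <= m + K * s.
  rewrite mulNr lerNl ler_pdivlMl//; nra.
by apply/andP; split; lra.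
Qed.

(** * Minimisers of the quadratically regularised cumulant function *)

Section regularised_minimum.
Context {R : realType} {h : nat} (Lam : 'rV[R]_h -> \bar R).
Local Notation D := (domain Lam).
Local Notation G := (fine \o Lam).

Definition convex_on_domain := forall (x y : 'rV[R]_h) (s : R),
  D x -> D y -> 0 <= s -> s <= 1 ->
  (Lam (s *: x + (1 - s) *: y) <= (s * G x + (1 - s) * G y)%:E)%E.

Hypothesis Lam_ge0 : forall x, (0 <= Lam x)%E.
Hypothesis Lam0 : Lam 0 = 0%E.
Hypothesis Lam_convex : convex_on_domain.
Hypothesis Lam_lsc : lower_semicontinuous Lam.
Hypothesis Lam_smooth : essentially_smooth Lam.
Hypothesis D0 : (domain Lam)° 0.

Let domE x : D x -> Lam x = (G x)%:E.
Proof. by rewrite /domain/= => Dx; rewrite fineK// ge0_fin_numE. Qed.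

Let G_ge0 x : 0 <= G x.
Proof. by rewrite /= fine_ge0. Qed.

Let interior_sub x : D° x -> D x.
Proof. exact: interior_subset. Qed.

(** If a ball of radius [r] about 0 lies in the domain, convex combinations of its points with [x]
    fill a ball of radius [(1 - s) * r] about [s *: x]. *)
Lemma domain_radial_interior x (s : R) : D x -> 0 <= s -> s < 1 -> D° (s *: x).
Proof.
move=> Dx s0 s1; have [r r0 Hr] := interior0_closed_ball D0.
have s10 : 0 < 1 - s by rewrite subr_gt0.
apply/nbhs_ballP; exists ((1 - s) * r) => /=; first by rewrite mulr_gt0.
move=> y; rewrite -ball_normE /= => yr.
have -> : y = s *: x + (1 - s) *: ((1 - s)^-1 *: (y - s *: x)).
  by rewrite scalerA divff ?gt_eqF// scale1r addrC subrK.
apply: (@le_lt_trans _ _ _ _ _ (Lam_convex Dx _ s0 (ltW s1))); last exact: ltry.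
apply: Hr; rewrite normrZ gtr0_norm ?invr_gt0// ler_pdivrMl//.
by rewrite distrC ltW.
Qed.

Let derive_le_convex x v : derivable G x v -> D x -> D (x + v) ->
  'D_v G x <= G (x + v) - G x.
Proof.
move=> dG Dx Dxv.
have Hq : q^-1 *: ((G \o shift x) (q *: v) - G x) @[q --> (0 : R)^'] --> 'D_v G x by [].
apply/ler_addgt0Pr => e e0.
move/cvgrPdist_le : Hq => /(_ _ e0)[r /= r0 Hr].
pose s := Num.min (r / 2) 1.
have s0 : 0 < s by rewrite lt_min divr_gt0/=.
have sr : s < r by rewrite gt_min ltr_pdivrMr// ltr_pMr// ltr1n.
have s1 : s <= 1 by rewrite ge_min lexx orbT.
have := Hr s; rewrite /= sub0r normrN gtr0_norm// => /(_ sr); rewrite gt_eqF// => /(_ isT).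
rewrite ler_norml => /andP[_]; set Q := _^-1 *: _ => H.
suff Qle : Q <= fine (Lam (x + v)) - fine (Lam x).
  by rewrite -lerBlDr; apply: le_trans Qle; rewrite lerBlDr -lerBlDl.
rewrite /Q [_ *: v + x]addrC /= ler_pdivrMl//.
have -> : x + s *: v = s *: (x + v) + (1 - s) *: x.
  by rewrite scalerDr scalerBl scale1r [RHS]addrC addrA subrK.
have := Lam_convex Dxv Dx (ltW s0) s1.
have : (Lam (s *: (x + v) + (1 - s) *: x) < +oo)%E.
  by apply: le_lt_trans (Lam_convex Dxv Dx (ltW s0) s1) _; exact: ltry.
by move/domE => ->; rewrite lee_fin /=; lra.
Qed.

Variables (x : 'rV[R]_h) (eps : R).
Hypothesis eps0 : 0 < eps.
Let w (theta : 'rV[R]_h) : R := eps / 2 * dot theta theta - dot theta x.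

Let continuous_w : continuous w.
Proof.
move=> z; have Fz : Filter (nbhs z) by exact: nbhs_filter.
apply: (@cvgB _ R^o _ (nbhs z)); last first.
  by under eq_fun do rewrite dotC; rewrite dotC; exact: continuous_dot.
apply: (@cvgMr _ _ (nbhs z)).
apply: (@cvg_big _ _ _ _ _ add_continuous _ (nbhs z)) => i _.
by apply: (@cvgM _ _ (nbhs z)); exact: coord_continuous.
Qed.

Let le_norm_dot (z : 'rV[R]_h) : `|z| ^+ 2 <= dot z z.
Proof.
have dz0 : 0 <= dot z z by apply: sumr_ge0 => i _; rewrite -expr2 sqr_ge0.
have : `|z| <= Num.sqrt (dot z z).
  apply: norm_le_coord; first exact: sqrtr_ge0.
  move=> i; rewrite -sqrtr_sqr ler_sqrt// /dot (bigD1 i)//= expr2 lerDl.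
  by apply: sumr_ge0 => j _; rewrite -expr2 sqr_ge0.
by rewrite -(@ler_sqr _ `|z|) ?nnegrE ?sqrtr_ge0// sqr_sqrtr.
Qed.

Lemma regularised_minimum_exists :
  exists2 p, D p & forall y, (Lam p + (w p)%:E <= Lam y + (w y)%:E)%E.
Proof.
pose A := \sum_(i < h) `|x 0 i|.
have A0 : 0 <= A by apply: sumr_ge0.
(* Beyond this radius the quadratic term of [w] dominates the linear one, as [A] bounds [dot y x] by
   [A] times the sup norm of [y]. There the objective is at least 0, its value at the origin, so
   minimising over the ball suffices. *)
pose rho := 2 * A / eps.
have rho0 : 0 <= rho by rewrite divr_ge0 ?mulr_ge0// ltW.
have wpos y : rho < `|y| -> 0 <= w y.
  move=> ry; have h1 := le_norm_dot y.
  have : `|dot y x| <= `|y| * A by rewrite dotC; exact: le_dot_norm.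
  rewrite ler_norml => /andP[_ h2].
  have h3 : A <= eps / 2 * `|y|.
    by move: ry; rewrite /rho ltr_pdivrMr// => ry; lra.
  have h4 : A * `|y| <= eps / 2 * `|y| ^+ 2.
    by rewrite expr2 mulrA ler_wpM2r.
  have h5 : eps / 2 * `|y| ^+ 2 <= eps / 2 * dot y y.
    by rewrite ler_wpM2l// divr_ge0// ltW.
  rewrite /w; lra.
pose K := [set y : 'rV[R]_h | `|y| <= rho].
have cK : compact K by exact: compact_norm_le.
have K0 : K 0 by rewrite /K/= normr0.
have w0 : w 0 = 0.
  have d0 y : dot (0 : 'rV[R]_h) y = 0 by rewrite -(scale0r y) dotZl mul0r.
  by rewrite /w !d0 mulr0 subr0.
have [|p Kp pmin] := lsc_min_compact (lscD_continuous Lam_lsc continuous_w) cK (ex_intro _ 0 K0).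
  by move=> y; rewrite ltNye_eq; case: (Lam y) (Lam_ge0 y).
have p0 : (Lam p + (w p)%:E <= 0)%E.
  by have := pmin _ K0; rewrite Lam0 w0 adde0.
exists p.
  move: (Lam_ge0 p) p0; rewrite /domain/=.
  by case: (Lam p) => [r _ _| _|//]; [exact: ltry|rewrite addye].
move=> y; have [yr|ry] := leP `|y| rho; first exact: pmin.
by apply: (le_trans p0); rewrite adde_ge0// lee_fin wpos.
Qed.

Variable p : 'rV[R]_h.
Hypotheses (Dp : D p) (pmin : forall y, (Lam p + (w p)%:E <= Lam y + (w y)%:E)%E).

Let pminR y : D y -> G p + w p <= G y + w y.
Proof. by move=> Dy; have := pmin y; rewrite (domE Dp) (domE Dy) -!EFinD lee_fin. Qed.

(** This is what contradicts steepness if [p] is a boundary point. Convexity and minimality of [p]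
    bound the slope at [s *: p] towards [p] by the growth of [w], hence by [C]. The gradient
    inequality at the points [e q] of a small sphere then bounds each signed partial derivative,
    times [r], by [M + C]. *)
Let gradient_bounded : exists B : R, forall s, 0 <= s -> s < 1 ->
  `|gradient G (s *: p)| <= B.
Proof.
have [r r0 Hr] := interior0_closed_ball D0.
pose e (q : 'I_h * bool) : 'rV[R]_h := (r * (-1) ^+ q.2) *: delta_mx 0 q.1.
have De q : D (e q).
  by apply: Hr; apply: norm_scaled_sign_delta; exact: ltW.
pose M := \sum_q G (e q).
have eM q : G (e q) <= M.
  by rewrite /M (bigD1 q)//= lerDl sumr_ge0// => j _; exact: G_ge0.
pose C := `|dot p x|.
exists ((M + C) / r) => s s0 s1; set u := s *: p.
have s10 : 0 < 1 - s by rewrite subr_gt0.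
have Du : D° u by exact: domain_radial_interior.
have dG : differentiable G u by exact: es_differentiable.
have dGv v : derivable G u v by exact: diff_derivable.
have DpC : 'D_p G u <= C.
  have := @derive_le_convex u ((1 - s) *: p) (dGv _) (interior_sub Du).
  rewrite -scalerDl addrC subrK scale1r => /(_ Dp).
  rewrite deriveE// linearZ /= -deriveE// => H1.
  have := pminR (interior_sub Du); rewrite /w /u !dotZl dotZr => H2.
  have q0 : 0 <= dot p p by apply: sumr_ge0 => i _; rewrite -expr2 sqr_ge0.
  have C1 : dot p x <= C by exact: ler_norm.
  have : (1 - s) * 'D_p G u <= (1 - s) * C.
    apply: (le_trans H1).
    have : 0 <= eps / 2 * ((1 - s) * (1 + s) * dot p p).
      apply: mulr_ge0; first by rewrite divr_ge0// ltW.
      by apply: mulr_ge0 => //; apply: mulr_ge0; [exact: ltW|exact: addr_ge0].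
    have : (1 - s) * dot p x <= (1 - s) * C by rewrite ler_wpM2l// ltW.
    move: H2; rewrite /= -/u; nra.
  by rewrite ler_pM2l.
have DuC : 'D_u G u <= C.
  rewrite deriveE// linearZ /= -deriveE//.
  have [D0'|D0'] := leP 0 ('D_p G u).
    by apply: le_trans DpC; rewrite ler_piMl// ltW.
  by apply: (@le_trans _ _ 0); rewrite ?normr_ge0// mulr_ge0_le0// ltW.
apply: norm_le_coord.
  apply: divr_ge0; last exact: ltW.
  apply: addr_ge0; last exact: normr_ge0.
  by rewrite /M; apply: sumr_ge0 => q _; exact: G_ge0.
move=> i; rewrite mxE ler_pdivlMr// mulrC.
have H (b : bool) : r * ((-1) ^+ b * 'D_(delta_mx 0 i) G u) <= M + C.
  have := @derive_le_convex u (e (i, b) - u) (dGv _) (interior_sub Du).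
  rewrite addrC subrK => /(_ (De _)).
  rewrite deriveE// linearB linearZ /= -!deriveE// => H1.
  have := eM (i, b); have := G_ge0 u; move: H1 DuC.
  rewrite /GRing.scale/= -mulrA; lra.
rewrite -[X in X * _](gtr0_norm r0) -normrM ler_norml.
have := H true; have := H false; rewrite expr0 expr1 mul1r mulN1r mulrN; lra.
Qed.

Lemma regularised_minimum_interior : D° p.
Proof.
apply: contrapT => Np.
pose s n : R := 1 - n.+2%:R^-1.
have s0 n : 0 <= s n by rewrite subr_ge0 invf_le1// ler1n.
have s1 n : s n < 1 by rewrite gtrBl invr_gt0.
have cs : s n *: p @[n --> \oo] --> p.
  rewrite -[X in _ --> X]scale1r; apply: cvgZr_tmp.
  rewrite -[X in _ --> X]subr0; apply: cvgB; first exact: cvg_cst.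
  by have := @cvg_harmonic R; rewrite -(cvg_shiftS).
have bp : boundary D p by split=> //; exact: subset_closure.
have := es_steep Lam_smooth (fun n => domain_radial_interior Dp (s0 n) (s1 n)) bp cs.
have [B HB] := gradient_bounded.
move/cvgryPge => /(_ (B + 1)) /filter_ex[n] /=.
by have := HB _ (s0 n) (s1 n); rewrite /=; lra.
Qed.

(** Minimality says that [G] lies above [- w] plus a constant, with equality at [p]: a parabola
    along each coordinate, of slope [(x - eps *: p) 0 i] and curvature term [eps / 2]. *)
Lemma regularised_minimum_gradient i :
  is_derive p (delta_mx 0 i) G ((x - eps *: p) 0 i).
Proof.
have Dip := regularised_minimum_interior.
have dG : derivable G p (delta_mx 0 i).
  by apply: diff_derivable; exact: es_differentiable.
split=> //; apply: (@derive_at_touching _ _ _ _ _ _ (eps / 2)) => //.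
  by rewrite divr_ge0// ltW.
have cp : p + s *: delta_mx 0 i @[s --> (0 : R)] --> p.
  rewrite -[X in _ --> X]addr0; apply: cvgD; first exact: cvg_cst.
  by rewrite -[X in _ --> X](scale0r (delta_mx 0 i : 'rV[R]_h)); apply: cvgZr_tmp.
near=> s.
have Ds : D (p + s *: delta_mx 0 i) by near: s; exact: (cp _ Dip).
have := pminR Ds; rewrite /w !dotDl !dotDr !dotZl !dotZr !dot_delta (dotC p (delta_mx 0 i)) dot_delta.
rewrite !mxE !eqxx /=; lra.
Unshelve. all: by end_near. Qed.

Lemma regularised_minimum_value : G p + w p <= 0.
Proof.
have D00 : D 0 by rewrite /domain/= Lam0.
have := pminR D00.
have d0 y : dot (0 : 'rV[R]_h) y = 0 by rewrite -(scale0r y) dotZl mul0r.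
by rewrite /w !d0 /= Lam0/= mulr0 subr0 addr0.
Qed.

End regularised_minimum.

Lemma interior_exposing_gradient (R : realType) (h : nat)
    (Lam : 'rV[R]_h -> \bar R) (x : 'rV[R]_h) (eps : R) :
  (forall y, (0 <= Lam y)%E) -> Lam 0 = 0%E -> convex_on_domain Lam ->
  lower_semicontinuous Lam -> essentially_smooth Lam -> (domain Lam)° 0 ->
  0 < eps -> exists theta, [/\ (domain Lam)° theta,
    (forall i, is_derive theta (delta_mx 0 i) (fine \o Lam) ((x - eps *: theta) 0 i)) &
    fine (Lam theta) + eps / 2 * dot theta theta <= dot theta x].
Proof.
move=> Lam_ge0 Lam0 cvx lsc smooth D0 eps0.
have [p Dp pmin] := regularised_minimum_exists Lam_ge0 Lam0 lsc x eps0.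
exists p; split.
- exact: (regularised_minimum_interior Lam_ge0 cvx smooth D0 eps0 Dp pmin).
- exact: (regularised_minimum_gradient Lam_ge0 cvx smooth D0 eps0 Dp pmin).
- have := regularised_minimum_value Lam_ge0 Lam0 Dp pmin; rewrite /=; lra.
Qed.

(** An open set is the union of the countably many boxes with rational centre and radius
    [m.+1%:R^-1] that it contains, and preimages of boxes are finite intersections of coordinate
    events. *)
Lemma is_random_vector_coord d (Omega : measurableType d) (R : realType)
    (h : nat) (Y : Omega -> 'rV[R]_h) :
  (forall i, measurable_fun setT (fun w => Y w 0 i)) -> is_random_vector Y.
Proof.
move=> mY B; rewrite /=.
pose bx (q : 'rV[rat]_h) (m : nat) :=
  [set x : 'rV[R]_h | forall i, `|x 0 i - ratr (q 0 i)| <= m.+1%:R^-1].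
have mbx q m : measurable (Y @^-1` bx q m).
  have -> : Y @^-1` bx q m = \bigcap_(i in [set: 'I_h])
      [set w | `|Y w 0 i - ratr (q 0 i)| <= m.+1%:R^-1].
    by apply/seteqP; split=> w H i; [move=> _; exact: H|exact: H].
  apply: fin_bigcap_measurable => // i _.
  rewrite -[X in measurable X]setTI; apply: measurable_fun_le => //.
  apply: (measurableT_comp (@normr_measurable R setT)).
  by apply: measurable_funB => //; exact: mY.
have mopen (V : set 'rV[R]_h) : open V -> measurable (Y @^-1` V).
  move=> oV.
  pose F n := if unpickle n is Some (q, m) then
    if pselect (bx q m `<=` V) then Y @^-1` bx q m else set0 else set0.
  have -> : Y @^-1` V = \bigcup_n F n.
    apply/seteqP; split=> w; last first.
      move=> [n _]; rewrite /F; case: (unpickle n) => [[q m]|//].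
      case: pselect => [bV|_ []]; by move=> /bV.
    rewrite /= => Vw; move: (oV); rewrite openE => /(_ _ Vw) /nbhs_ballP[e /= e0 eV].
    (* Two points of one box are at distance at most twice its radius, which must stay below [e]. *)
    pose m := Num.truncn (2 / e).
    have me : 2 * m.+1%:R^-1 < e.
      by rewrite ltr_pdivrMr// mulrC -ltr_pdivrMr// truncnS_gt.
    have m0 : 0 < (m.+1%:R^-1 : R) by rewrite invr_gt0.
    have qex i : exists q : rat, `|Y w 0 i - ratr q| <= m.+1%:R^-1.
      have /rat_in_itvoo[q] : Y w 0 i - m.+1%:R^-1 < Y w 0 i by rewrite gtrBl.
      rewrite in_itv/= => /andP[q1 q2]; exists q.
      by rewrite ger0_norm ?subr_ge0; [rewrite lerBlDr -lerBlDl ltW|exact: ltW].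
    have [qf Hq] := choice qex.
    pose q : 'rV[rat]_h := \row_i qf i.
    exists (pickle (q, m)) => //; rewrite /F pickleK.
    case: pselect => [_ i|[]]; first by rewrite mxE; exact: Hq.
    move=> x xb; apply: eV; rewrite -ball_normE /=.
    apply: le_lt_trans me; apply: norm_le_coord; first by rewrite mulr_ge0// ltW.
    move=> i; have := Hq i; have := xb i; rewrite !mxE.
    rewrite !ler_norml; set u := _^-1 => /andP[h1 h2] /andP[h3 h4]; apply/andP; split; lra.
  apply: bigcupT_measurable => n; rewrite /F; case: (unpickle n) => [[q m]|]; last exact: measurable0.
  by case: pselect => a /=; [exact: mbx|exact: measurable0].
pose A := [set B : set 'rV[R]_h | measurable (Y @^-1` B)].
suff : <<s open >> `<=` A by exact.
apply: smallest_sub => //; split.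
- by rewrite /A/= preimage_set0.
- move=> V; rewrite /A/= => mV; rewrite setTD preimage_setC; exact: measurableC.
- by move=> V mV; rewrite /A/= preimage_bigcup; exact: bigcupT_measurable.
Qed.

(** * The Legendre transform as a rate function *)

Section legendre.
Context {R : realType} {h : nat}.

(** At [Upsilon] this is [J_LD] by conversion, [dot] unfolding to the sum written there. *)
Definition legendre (Lam : 'rV[R]_h -> \bar R) (x : 'rV[R]_h) : \bar R :=
  ereal_sup [set ((dot theta x)%:E - Lam theta)%E | theta in [set: 'rV[R]_h]].

Variable Lam : 'rV[R]_h -> \bar R.

Lemma legendre_ge0 : Lam 0 = 0%E -> forall x, (0 <= legendre Lam x)%E.
Proof.
move=> Lam0 x; apply: ereal_sup_ubound; exists 0 => //.
by rewrite Lam0 sube0 -(scale0r x) dotZl mul0r.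
Qed.

Hypothesis Lam_ge0 : forall x, (0 <= Lam x)%E.

Lemma lt_legendre x (a : R) : (a%:E < legendre Lam x)%E ->
  exists2 theta, domain Lam theta & a + fine (Lam theta) < dot theta x.
Proof.
move=> /ereal_sup_gt[_ [theta _ <-]].
case E : (Lam theta) (Lam_ge0 theta) => [r| |//] r0.
  rewrite -EFinB lte_fin => ar; exists theta; rewrite /domain/= E ?ltry//=; lra.
by [].
Qed.

Lemma legendre_lsc : lower_semicontinuous (legendre Lam).
Proof.
move=> x a /lt_legendre[theta Dth ath].
exists [set y | a + fine (Lam theta) < dot theta y].
  exact: (@continuous_dot _ _ theta x) (lt_nbhsr ath).
move=> y /= ay; apply: (@lt_le_trans _ _ (dot theta y - fine (Lam theta))%:E).
  by rewrite lte_fin; lra.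
apply: ereal_sup_ubound; exists theta => //.
by rewrite EFinB fineK// ge0_fin_numE.
Qed.

End legendre.

Section gartner_ellis.
Context d (Omega : measurableType d) (R : realType) (P : probability Omega R).
Context (h : nat) (Z : R -> Omega -> 'rV[R]_h) (Lam : 'rV[R]_h -> \bar R).

Hypothesis mZ : forall t i, 0 < t -> measurable_fun setT (fun w => Z t w 0 i).
Hypothesis Lam_ge0 : forall x, (0 <= Lam x)%E.
Hypothesis Lam0 : Lam 0 = 0%E.
Hypothesis Lam_convex : convex_on_domain Lam.
Hypothesis Lam_lsc : lower_semicontinuous Lam.
Hypothesis Lam_smooth : essentially_smooth Lam.
Hypothesis D0 : (domain Lam)° 0.
Hypothesis mgf_le : forall theta, domain Lam theta ->
  exp_rate_le (mgf P Z theta) (fine (Lam theta)).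
Hypothesis mgf_ge : forall theta, (domain Lam)° theta ->
  exp_rate_ge (mgf P Z theta) (fine (Lam theta)).

Let random_vector t : 0 < t -> is_random_vector (Z t).
Proof. by move=> t0; apply: is_random_vector_coord => i; exact: mZ. Qed.

(* Outside a large ball the half-spaces with normals [+- r e_i] suffice; the
   rest of [C] is compact. *)
Let halfspace_cover (C : set 'rV[R]_h) (l : R) : closed C ->
  (forall x, C x -> (l%:E < legendre Lam x)%E) ->
  exists2 s : seq 'rV[R]_h, {in s, forall theta, domain Lam theta} &
    forall x, C x -> exists2 theta, theta \in s & l + fine (Lam theta) < dot theta x.
Proof.
move=> cC lC.
have [r r0 Hr] := interior0_closed_ball D0.
pose e (q : 'I_h * bool) : 'rV[R]_h := (r * (-1) ^+ q.2) *: delta_mx 0 q.1.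
have De q : domain Lam (e q).
  by apply: Hr; apply: norm_scaled_sign_delta; exact: ltW.
pose M := \sum_q fine (Lam (e q)).
have eM q : fine (Lam (e q)) <= M.
  by rewrite /M (bigD1 q)//= lerDl sumr_ge0// => j _; rewrite fine_ge0.
have M0 : 0 <= M by apply: sumr_ge0 => q _; rewrite fine_ge0.
(* Beyond [rho] some signed coordinate times [r] exceeds [|l| + M + 1], hence [l + Lam (e q)] for
   the corresponding [q]. *)
pose rho := (`|l| + M + 1) / r.
have rho0 : 0 <= rho by rewrite divr_ge0 ?addr_ge0// ltW.
have rhor : r * rho = `|l| + M + 1 by rewrite mulrC divfK// gt_eqF.
pose K := [set y : 'rV[R]_h | `|y| <= rho].
have cK : compact (K `&` C) by apply: compact_closedI => //; exact: compact_norm_le.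
have [s sD scov] := @compact_seq_cover _ _ _ (domain Lam)
  (fun theta => [set x | l + fine (Lam theta) < dot theta x]) cK
  (fun theta _ => open_comp (fun x _ => @continuous_dot _ _ theta x) (@open_gt _ _))
  (fun x Kx => lt_legendre Lam_ge0 (lC x (proj2 Kx))).
exists (s ++ [seq e q | q <- index_enum ('I_h * bool)%type]).
  move=> theta; rewrite mem_cat => /orP[|/mapP[q _ ->]//]; exact: sD.
move=> x Cx; have [xr|xr] := leP `|x| rho.
  have [theta ts Hx] := scov x (conj xr Cx).
  by exists theta; rewrite ?mem_cat ?ts.
have [i xi] : exists i, rho < `|x 0 i|.
  apply: contrapT => /forallNP H; move: xr; rewrite ltNge => /negP; apply.
  by apply: norm_le_coord => // i; rewrite leNgt; exact/negP.
have [b xb] := lt_normr_sign xi.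
exists (e (i, b)); first by rewrite mem_cat map_f ?mem_index_enum ?orbT.
rewrite /e dotZl dot_delta /= -mulrA.
have : r * rho < r * ((-1) ^+ b * x 0 i) by rewrite ltr_pM2l.
have := eM (i, b); have := ler_norm l; rewrite rhor; lra.
Qed.

(** Chernoff bounds summed over the finite cover by half-spaces: the constant in each half-space was
    chosen so that the cumulant cancels and every term has rate [- l]. *)
Lemma ldp_closed_rate (C : set 'rV[R]_h) (l : R) : closed C ->
  (forall x, C x -> (l%:E < legendre Lam x)%E) ->
  exp_rate_le (fun t => P (Z t @^-1` C)) (- l).
Proof.
move=> cC lC; have [s sD scov] := halfspace_cover cC lC.
apply: (@exp_rate_le_le _ _ (fun t => \sum_(theta <- s)
   (expR (t * - (l + fine (Lam theta))))%:E * mgf P Z theta t)%E).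
  apply: filterS near_pinfty_gt0 => t t0.
  pose f theta w := expR (t * - (l + fine (Lam theta))) * expR (t * dot theta (Z t w)).
  have mf theta : measurable_fun setT (f theta).
    by apply: measurable_funM => //; exact: measurable_expR_dot.
  have f0 theta w : 0 <= f theta w by rewrite mulr_ge0 ?expR_ge0.
  apply: (@le_trans _ _ (\int[P]_w (\sum_(theta <- s) f theta w)%:E)%E).
    apply: measure_le_integral.
    - have -> : Z t @^-1` C = ~` (Z t @^-1` ~` C) by rewrite preimage_setC setCK.
      apply: measurableC; apply: random_vector => //.
      by apply: sub_sigma_algebra; exact: closed_openC.
    - exact: measurable_sum.
    - by move=> w; exact: sumr_ge0.
    - move=> w /= /scov[theta ts Hw].
      apply: (@le_trans _ _ (f theta w)).
        by rewrite /f -expRD -expR0 ler_expR -mulrDr mulr_ge0 ?(ltW t0)//; lra.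
      by rewrite (big_rem theta)//= lerDl sumr_ge0.
  under eq_integral do rewrite -sumEFin.
  rewrite ge0_integral_sum//; last 2 first.
  - by move=> theta; apply/measurable_EFinP; exact: mf.
  - by move=> theta w _; rewrite lee_fin.
  apply: lee_sum => theta _; rewrite /f.
  under eq_integral do rewrite EFinM.
  rewrite ge0_integralZl_EFin ?expR_ge0//.
  by apply/measurable_EFinP; exact: measurable_expR_dot.
apply: exp_rate_le_sum => theta ts.
have -> : - l = - (l + fine (Lam theta)) + fine (Lam theta) by ring.
by apply: exp_rate_leM; apply: mgf_le; exact: sD.
Qed.

Lemma ldp_open_rate (O : set 'rV[R]_h) (x : 'rV[R]_h) (r : R) : open O -> O x ->
  legendre Lam x = r%:E -> exp_rate_ge (fun t => P (Z t @^-1` O)) (- r).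
Proof.
move=> oO Ox xr.
have r0 : 0 <= r by rewrite -lee_fin -xr legendre_ge0.
move: (oO); rewrite openE => /(_ _ Ox) /nbhs_ballP[e /= e0 eO].
(* The gradient [y] is to be within [del] of [x], so that a box of size [del] about [y] stays in the
   ball of radius [e]. Comparing the regularised value with the supremum gives
   [eps * dot theta theta <= 2 * r]; then the squared distance from [x] to [y] is at most
   [eps * (2 * r)], and [eps] is chosen to make this at most [del ^+ 2]. The added 1 covers
   [r = 0]. *)
pose del := e / 3.
have del0 : 0 < del by rewrite divr_gt0.
pose eps := del ^+ 2 / (2 * r + 1).
have r10 : 0 < 2 * r + 1 by rewrite ltr_wpDl// mulr_ge0.
have eps0 : 0 < eps by rewrite divr_gt0// exprn_gt0.
have [theta [Dth grad val]] :=
  interior_exposing_gradient x Lam_ge0 Lam0 Lam_convex Lam_lsc Lam_smooth D0 eps0.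
set y := x - eps *: theta in grad.
have Dth' : domain Lam theta := interior_subset Dth.
have le_r : dot theta x - fine (Lam theta) <= r.
  rewrite -lee_fin -xr; apply: ereal_sup_ubound; exists theta => //.
  by rewrite EFinB fineK// ge0_fin_numE.
have q_le : eps * dot theta theta <= 2 * r by lra.
have xy : `|x - y| <= del.
  rewrite /y opprB addrC subrK; apply: norm_le_coord; first exact: ltW.
  move=> i; rewrite mxE -ler_sqr ?nnegrE ?normr_ge0 ?(ltW del0)//.
  rewrite -normrX ger0_norm ?sqr_ge0// exprMn.
  have qi : theta 0 i ^+ 2 <= dot theta theta.
    rewrite /dot (bigD1 i)//= expr2 lerDl sumr_ge0// => j _.
    by rewrite -expr2 sqr_ge0.
  apply: (@le_trans _ _ (eps * (eps * dot theta theta))).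
    by rewrite mulrA -expr2 ler_wpM2l ?sqr_ge0.
  apply: (@le_trans _ _ (eps * (2 * r + 1))).
    by rewrite ler_wpM2l ?(ltW eps0)//; lra.
  by rewrite divfK// gt_eqF.
have H := @tilted_lower_bound _ _ _ P h Z mZ (fine \o Lam) theta y (mgf_ge Dth) _ grad del del0.
apply: exp_rate_geW (exp_rate_ge_ge _ (H _)).
- rewrite /y dotDr dotNr dotZr /=.
  have : 0 <= eps * dot theta theta.
    by apply: mulr_ge0; [exact: ltW|apply: sumr_ge0 => i _; rewrite -expr2 sqr_ge0].
  lra.
- apply: filterS near_pinfty_gt0 => t t0.
  apply: le_measure; rewrite ?inE; [exact: measurable_box| |].
    apply: random_vector => //; exact: sub_sigma_algebra.
  move=> w bw; apply: eO; rewrite -ball_normE /=.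
  have -> : x - Z t w = (x - y) + (y - Z t w) by rewrite addrA subrK.
  apply: (le_lt_trans (ler_normD _ _)).
  have : `|y - Z t w| <= del.
    apply: norm_le_coord => [|i]; first exact: ltW.
    by rewrite mxE [(- Z t w) 0 i]mxE distrC; exact: bw.
  rewrite /del in xy *; lra.
- apply: filterS (nbhs_interior Dth) => eta Deta.
  apply: mgf_le; exact: (interior_subset Deta).
Qed.

Theorem gartner_ellis : satisfies_LDP P Z (fun t => t) (legendre Lam).
Proof.
split.
- by move=> t t0; exact: random_vector.
- exact: cvg_id.
- split; [exact: legendre_lsc|exact: legendre_ge0].
- move=> C cC.
  set I := ereal_inf _.
  have I0 : (0 <= I)%E by apply: le_ereal_inf_tmp => _ [x _ <-]; exact: legendre_ge0.
  set u := limf_esup _ _.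
  (* A level strictly below the infimum lets each point of [C] choose its [theta] although the
     supremum need not be attained; it also treats finite and infinite [I] alike. *)
  have uI l : (l%:E < I)%E -> (u <= (- l)%:E)%E.
    move=> lI; apply: limf_esup_rate_le; apply: ldp_closed_rate => // x Cx.
    by apply: (lt_le_trans lI); apply: ereal_inf_lbound; exists x.
  move: I0 uI; case: (I) => [i _ uI| _ uI|//].
    apply/lee_addgt0Pr => e e0; rewrite -EFinN -EFinD.
    by have := uI (i - e); rewrite lte_fin gtrBl opprB addrC; exact.
  move: uI; case: u => [v| |] uI; rewrite ?leey//.
    by have := uI (1 - v)%R; rewrite ltry => /(_ isT); rewrite lee_fin opprB lerBrDr gerDl ler10.
  by have := uI 0%R; rewrite ltry leye_eq => /(_ isT).
- move=> O oO.
  rewrite leeNl; apply: le_ereal_inf_tmp => _ [x Ox <-].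
  rewrite leeNl.
  have := legendre_ge0 Lam0 x; case E : (legendre Lam x) => [r| |//] r0.
    by rewrite -EFinN; apply: limf_einf_rate_ge; exact: ldp_open_rate E.
  by rewrite leNye.
Qed.

End gartner_ellis.

(** * The function Upsilon *)

Section kappa_theory.
Context d (Omega : measurableType d) (R : realType) (P : probability Omega R).
Variable X : R -> {RV P >-> R}.

Let mexp (theta c : R) : measurable_fun setT (fun w => expR (theta * X 1 w - c)).
Proof.
apply: measurableT_comp => //; apply: measurable_funB => //; exact: measurable_funM.
Qed.

Let kappaE theta : kappa X theta = lne (\int[P]_w (expR (theta * X 1 w))%:E)%E.
Proof.
rewrite /kappa /mmt_gen_fun unlock; congr lne.
by apply: eq_integral => w _; rewrite /= mulrC.
Qed.

Let mgf_gt0 theta : (0 < \int[P]_w (expR (theta * X 1 w))%:E)%E.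
Proof.
rewrite lt0e integral_ge0 ?andbT; last by move=> w _; rewrite lee_fin expR_ge0.
apply/eqP => I0.
have mE : measurable_fun setT (fun w => (expR (theta * X 1 w))%:E).
  by apply/measurable_EFinP; apply: measurableT_comp => //; exact: measurable_funM.
have : (\int[P]_w `|(expR (theta * X 1 w))%:E| = 0)%E.
  by rewrite -[RHS]I0; apply: eq_integral => w _; rewrite gee0_abs// lee_fin expR_ge0.
move/(ae_eq_integral_abs P measurableT mE) => [N [mN N0 sub]].
have NT : N = setT.
  apply/seteqP; split=> // w _; apply: sub => /= /(_ I) [] /eqP.
  by rewrite gt_eqF// expR_gt0.
by move: N0; rewrite NT; apply/eqP; rewrite [X in X != _]probability_setT oner_neq0.
Qed.

Lemma kappaNy theta : kappa X theta != -oo%E.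
Proof.
rewrite kappaE; move: (mgf_gt0 theta).
by case: (\int[P]_w _)%E => [r| |//]//=; rewrite lte_fin => r0; rewrite leNgt r0.
Qed.

Lemma kappa0 : kappa X 0 = 0%E.
Proof.
rewrite kappaE; under eq_integral do rewrite mul0r expR0.
by rewrite integral_cst// mul1e [X in lne X]probability_setT lne1.
Qed.

Let mgf_kappa theta : kappa X theta \is a fin_num ->
  (\int[P]_w (expR (theta * X 1 w - fine (kappa X theta)))%:E = 1)%E.
Proof.
move=> kf; under eq_integral do rewrite expRD mulrC EFinM.
rewrite ge0_integralZl_EFin ?expR_ge0//; last first.
  by apply/measurable_EFinP; apply: measurableT_comp => //; exact: measurable_funM.
move: kf (mgf_gt0 theta); rewrite kappaE; case: (\int[P]_w _)%E => [r| |//]//= _.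
by rewrite lte_fin => r0; rewrite leNgt r0/= expRN lnK// -EFinM mulVf ?gt_eqF.
Qed.

(* Pointwise convexity of [expR] applied to the normalised exponents
   [a * X - kappa a] and [b * X - kappa b], whose exponentials have mean 1. *)
Lemma kappa_convex (a b s : R) : kappa X a \is a fin_num -> kappa X b \is a fin_num ->
  0 <= s -> s <= 1 ->
  (kappa X (s * a + (1 - s) * b) <=
   (s * fine (kappa X a) + (1 - s) * fine (kappa X b))%:E)%E.
Proof.
move=> ka kb s0 s1.
set m := s * _ + (1 - s) * fine _.
have I1 : (\int[P]_w (expR ((s * a + (1 - s) * b) * X 1 w - m))%:E <= 1)%E.
  apply: (@le_trans _ _ (\int[P]_w
     (s%:E * (expR (a * X 1 w - fine (kappa X a)))%:E +
      (1 - s)%:E * (expR (b * X 1 w - fine (kappa X b)))%:E))%E).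
    apply: ge0_le_integral => //.
    - exact/measurable_EFinP.
    - by apply: emeasurable_funD; apply: emeasurable_funM => //; apply/measurable_EFinP.
    - move=> w _; rewrite -!EFinM -EFinD lee_fin.
      have := convex_expR (Itv01 s0 s1) (a * X 1 w - fine (kappa X a))
        (b * X 1 w - fine (kappa X b)).
      rewrite !convRE /=; apply: le_trans; rewrite ler_expR /m /unstable.onem; lra.
  rewrite ge0_integralD//.
  - rewrite !ge0_integralZl_EFin ?subr_ge0//.
    + by rewrite !mgf_kappa// !mule1 -EFinD addrC subrK.
    + exact/measurable_EFinP.
    + exact/measurable_EFinP.
  - by move=> w _; rewrite -EFinM lee_fin mulr_ge0// expR_ge0.
  - by apply: emeasurable_funM => //; apply/measurable_EFinP.
  - by move=> w _; rewrite -EFinM lee_fin mulr_ge0 ?subr_ge0// expR_ge0.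
  - by apply: emeasurable_funM => //; apply/measurable_EFinP.
move: I1; under eq_integral do rewrite expRD mulrC EFinM.
rewrite ge0_integralZl_EFin ?expR_ge0//; last first.
  by apply/measurable_EFinP; apply: measurableT_comp => //; exact: measurable_funM.
rewrite kappaE; move: (mgf_gt0 (s * a + (1 - s) * b)).
case: (\int[P]_w _)%E => [r| |//].
  rewrite lte_fin => r0; rewrite -EFinM lee_fin expRN ler_pdivrMl ?expR_gt0// mulr1 => rm.
  by rewrite lne_EFin// lee_fin -ler_expR lnK.
by rewrite gt0_muley ?lte_fin ?expR_gt0// leye_eq.
Qed.

End kappa_theory.

(** The positive part is convex, and the power [nu^-1 >= 1] is convex and nondecreasing on
    nonnegative reals. *)
Lemma inverse_stable_rate_convex (R : realType) (nu x y s : R) :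
  0 < nu -> nu < 1 -> 0 <= s -> s <= 1 ->
  inverse_stable_rate nu (s * x + (1 - s) * y) <=
  s * inverse_stable_rate nu x + (1 - s) * inverse_stable_rate nu y.
Proof.
move=> nu0 nu1 s0 s1; rewrite /inverse_stable_rate.
have inu : 1 <= nu^-1 by rewrite invf_ge1// ltW.
have s10 : 0 <= 1 - s by rewrite subr_ge0.
apply: (@le_trans _ _ ((s * Num.max x 0 + (1 - s) * Num.max y 0) `^ nu^-1)).
  have m0 z : 0 <= Num.max z 0 :> R by rewrite le_max lexx orbT.
  have mz z : z <= Num.max z 0 :> R by rewrite le_max lexx.
  apply: ge0_ler_powR; rewrite ?nnegrE ?invr_ge0 ?(ltW nu0)//.
    by rewrite addr_ge0 ?mulr_ge0.
  by rewrite ge_max addr_ge0 ?mulr_ge0// andbT lerD// ler_wpM2l.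
have := @convex_powR R _ inu (Itv01 s0 s1) (Num.max x 0) (Num.max y 0).
rewrite !convRE /= /unstable.onem; apply.
  by rewrite inE/= in_itv/= le_max lexx orbT.
by rewrite inE/= in_itv/= le_max lexx orbT.
Qed.

Lemma inverse_stable_rate_le (R : realType) (nu x y : R) :
  0 < nu -> x <= y -> inverse_stable_rate nu x <= inverse_stable_rate nu y.
Proof.
move=> nu0 xy; apply: ge0_ler_powR.
- by rewrite invr_ge0 ltW.
- by rewrite nnegrE le_max lexx orbT.
- by rewrite nnegrE le_max lexx orbT.
- by rewrite ge_max !le_max xy lexx orbT.
Qed.

Section upsilon_theory.
Context d (Omega : measurableType d) (R : realType) (P : probability Omega R).
Context (h k : nat) (c : 'I_h -> 'I_k -> R) (nu : R) (S : 'I_h -> R -> {RV P >-> R}).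
Hypotheses (k_gt0 : (0 < k)%N) (c_gt0 : forall i j, 0 < c i j).
Hypotheses (nu_gt0 : 0 < nu) (nu_lt1 : nu < 1).

Local Notation Ups := (Upsilon c nu S).
Implicit Types theta : 'rV[R]_h.

Let term_ge0 (x : \bar R) : (0 <= if 0 <= x then x `^ nu^-1 else 0)%E.
Proof. by case: ifP => // _; exact: poweR_ge0. Qed.

Lemma Upsilon_ge0 theta : (0 <= Ups theta)%E.
Proof. by apply: sume_ge0 => j _; exact: term_ge0. Qed.

Lemma Upsilon_finE theta : finite_kappa S theta ->
  Ups theta = (Upsilon_fin c nu S theta)%:E.
Proof.
move=> fk; rewrite /Upsilon_fin -sumEFin; apply: eq_bigr => j _.
have -> : (\sum_(i < h) (c i j)%:E * kappa (S i) (theta 0%R i) =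
    (drift c S (theta 0) j)%:E)%E.
  rewrite /drift -sumEFin; apply: eq_bigr => i _.
  by rewrite EFinM fineK.
set x := drift _ _ _ _; rewrite /= lee_fin /inverse_stable_rate.
have [x0|x0] := leP 0 x => //.
by rewrite powR0// invr_neq0// gt_eqF.
Qed.

(** Positive weights and cumulants different from [-oo] exclude cancellation, so a single infinite
    cumulant makes the first summand over [j], which exists as [k] is positive, infinite. *)
Lemma Upsilon_domainE theta : domain Ups theta <-> finite_kappa S theta.
Proof.
split=> [Dth i|fk]; last by rewrite /domain/= Upsilon_finE// ltry.
rewrite fin_numE kappaNy/=; apply/eqP => ki.
have : Ups theta != +oo%E by rewrite lt_eqF.
rewrite /Upsilon esum_eqy; last first.
  by move=> j _; rewrite gt_eqF// (lt_le_trans _ (term_ge0 _))// ltNy0.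
move=> /negP; apply; apply/existsP; exists (Ordinal k_gt0); rewrite /=.
have -> : (\sum_(i' < h) (c i' (Ordinal k_gt0))%:E * kappa (S i') (theta 0%R i') = +oo)%E.
  apply/esum_eqyP; last first.
    by exists i; split; rewrite ?mem_index_enum// ki gt0_muley// lte_fin.
  move=> i' _; have := kappaNy (S i') (theta 0 i').
  case: (kappa _ _) => [r| |]// _; by rewrite gt0_muley// lte_fin.
by rewrite leey poweRyr// invr_neq0// gt_eqF.
Qed.

Lemma Upsilon0 : Ups 0 = 0%E.
Proof.
rewrite /Upsilon big1// => j _; rewrite big1.
  by rewrite lexx poweR0r// invr_neq0// gt_eqF.
by move=> i _; rewrite mxE kappa0 mule0.
Qed.

(** Convexity of the cumulants survives positive weights, and then composition with the convex
    nondecreasing [inverse_stable_rate]. *)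
Lemma Upsilon_convex : convex_on_domain Ups.
Proof.
move=> x y s /Upsilon_domainE fx /Upsilon_domainE fy s0 s1.
have kc i := kappa_convex (fx i) (fy i) s0 s1.
have fz : finite_kappa S (s *: x + (1 - s) *: y).
  move=> i; rewrite fin_numE kappaNy/= !mxE -ltey.
  by apply: (le_lt_trans (kc i)); exact: ltry.
rewrite (Upsilon_finE fz) /= (Upsilon_finE fx) (Upsilon_finE fy) /= lee_fin.
rewrite /Upsilon_fin !mulr_sumr -big_split/=; apply: ler_sum => j _.
apply: le_trans (inverse_stable_rate_convex _ _ nu_gt0 nu_lt1 s0 s1).
apply: inverse_stable_rate_le => //.
rewrite /drift !mulr_sumr -big_split/=; apply: ler_sum => i _.
rewrite mulrCA (mulrCA (1 - s)) -mulrDr ler_wpM2l ?(ltW (c_gt0 _ _))//.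
by rewrite -lee_fin fineK ?fz// !mxE.
Qed.

Lemma Upsilon_domain_interior0 :
  (forall i, \forall theta \near (0 : R), kappa (S i) theta \is a fin_num) ->
  (domain Ups)° 0.
Proof.
move=> kfin.
pose fin i := [set theta : 'rV[R]_h | kappa (S i) (theta 0 i) \is a fin_num].
have fin_nbhs i : nbhs (0 : 'rV[R]_h) (fin i).
  have H : nbhs ((0 : 'rV[R]_h) 0 i) [set x | kappa (S i) x \is a fin_num].
    by rewrite mxE; exact: kfin.
  exact: (@coord_continuous R 1 h 0 i 0) H.
have F0 : Filter (nbhs (0 : 'rV[R]_h)) by exact: nbhs_filter.
by apply: filterS (filter_forall F0 fin_nbhs) => theta fk; apply/Upsilon_domainE.
Qed.

End upsilon_theory.

Theorem proposition5p1 (d : measure_display) (Omega : measurableType d)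
    (R : realType) (P : probability Omega R) (h k : nat)
    (c : 'I_h -> 'I_k -> R) (nu : R)
    (S : 'I_h -> R -> {RV P >-> R}) (L : 'I_k -> R -> {RV P >-> R})
    (h_ge1 : (1 <= h)%N) (k_ge1 : (1 <= k)%N)
    (c_gt0 : forall i j, 0 < c i j)
    (nu_gt0 : 0 < nu) (nu_lt1 : nu < 1)
    (S_levy : forall i, is_levy_process (S i))
    (S_kappa : forall i,
       \forall theta \near (0 : R), kappa (S i) theta \is a fin_num)
    (L_inverse : forall j, is_inverse_stable_subordinator nu (L j))
    (indep : independent_processes (all_processes S L))
    (Upsilon_smooth : essentially_smooth (Upsilon c nu S))
    (Upsilon_lsc : lower_semicontinuous (Upsilon c nu S)) :
  satisfies_LDP P (scaled_time_changed c S L) (fun t : R => t)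
    (J_LD c nu S).
Proof.
have domE := Upsilon_domainE S k_ge1 c_gt0 nu_gt0.
have D0 := Upsilon_domain_interior0 k_ge1 c_gt0 nu_gt0 S_kappa.
apply: (@gartner_ellis _ _ _ P h (scaled_time_changed c S L) (Upsilon c nu S)) => //.
- by move=> t i t0; exact: (measurable_scaled_time_changed c_gt0 S_levy L_inverse).
- exact: Upsilon_ge0.
- exact: Upsilon0.
- exact: Upsilon_convex.
- move=> theta /domE fk; rewrite (Upsilon_finE _ nu_gt0 fk) /=.
  exact: mgf_scaled_time_changed_rate_le.
- move=> theta Dth.
  have /domE fk := interior_subset Dth.
  (* An interior point remains in the domain after multiplication by some [p > 1], the exponent
     needed for uniform integrability. *)
  have cp : p *: theta @[p --> (1 : R)^'+] --> theta.
    rewrite -[X in _ --> X]scale1r; apply: cvgZr_tmp.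
    exact: cvg_at_right_filter.
  have [p [p1 Dp]] := filter_ex (filterI (nbhs_right_gt (1 : R)) (cp _ Dth)).
  rewrite (Upsilon_finE _ nu_gt0 fk) /=.
  apply: (@mgf_scaled_time_changed_rate_ge _ _ _ _ _ _ _ _ _ _ _ _ _ _ _ _ _ theta p) => //.
  exact/domE.
Qed.
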